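(* Let $k$ be an algebraically closed field of characteristic $p\ge 0$ and let $X$ be a hyperelliptic curve over $k$ of genus $g\ge 2$. Then the hyperelliptic involution of $X$ acts on $H^1_{\mathrm{dR}}(X/k)$ by multiplication by $-1$.
   Context: Curves are smooth, projective and irreducible. A curve $X$ over $k$ is hyperelliptic if there is a finite separable morphism $\pi\colon X\to\mathbb{P}^1_k$ of degree two; such a $\pi$ is fixed. The hyperelliptic involution is the unique non-trivial automorphism $\sigma$ of $X$ such that $\pi\circ\sigma=\pi$. $H^1_{\mathrm{dR}}(X/k)$ is the first hypercohomology of the de-Rham complex $\mathcal{O}_X\xrightarrow{d}\Omega_X$, and automorphisms of $X$ act on it by pull-back. *)

(* Defs.v *)
From HB Require Import structures.
From mathcomp Require Import all_boot all_order all_algebra all_field.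
From mathcomp Require Import boolp classical_sets functions.
From mathcomp Require Import ring_quotient freeg mpoly.

Set Implicit Arguments.
Unset Strict Implicit.
Unset Printing Implicit Defensive.

Import GRing.Theory.
Local Open Scope ring_scope.
Local Open Scope quotient_scope.
Local Open Scope classical_set_scope.

Section LmodQuotient.
Variables (R : nzRingType) (V : lmodType R) (S : submodClosed V).

Definition lquot_pred : {pred V} := fun v => v \in S.

Fact lquot_pred_zmod : zmod_closed lquot_pred.
Proof.
split=> [|u v uS vS]; rewrite unfold_in /lquot_pred ?rpred0 //.
by rewrite -scaleN1r rpredD ?rpredZ.
Qed.

HB.instance Definition _ := GRing.isZmodClosed.Build V lquot_pred lquot_pred_zmod.

Definition lquot : Type := @Quotient.quot V lquot_pred.

HB.instance Definition _ := Choice.on lquot.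
HB.instance Definition _ := GRing.Zmodule.on lquot.

Definition lquot_pi (v : V) : lquot := \pi_(@Quotient.quot V lquot_pred) v.

Lemma lquot_piP u v : lquot_pi u = lquot_pi v <-> u - v \in S.
Proof.
rewrite -[u - v \in S]/(u - v \in lquot_pred) Quotient.idealrBE.
by split=> [/eqP|/eqP].
Qed.

Lemma lquot_piD u v : lquot_pi (u + v) = lquot_pi u + lquot_pi v.
Proof. by rewrite /lquot_pi [LHS]raddfD. Qed.

Lemma lquot_piK (w : lquot) : lquot_pi (repr w) = w.
Proof. exact: reprK. Qed.

Definition lquot_scale (a : R) (w : lquot) : lquot := lquot_pi (a *: repr w).

Lemma lquot_piZ a v : lquot_pi (a *: v) = lquot_scale a (lquot_pi v).
Proof.
apply/lquot_piP; rewrite -scalerBr rpredZ //; apply/lquot_piP.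
by rewrite lquot_piK.
Qed.

Fact lquot_scaleA a b w :
  lquot_scale a (lquot_scale b w) = lquot_scale (a * b) w.
Proof. by rewrite -[w]lquot_piK -!lquot_piZ scalerA. Qed.

Fact lquot_scale1 : left_id 1 lquot_scale.
Proof. by move=> w; rewrite -[w]lquot_piK -!lquot_piZ scale1r. Qed.

Fact lquot_scaleDr : right_distributive lquot_scale +%R.
Proof.
move=> a u v; rewrite -[u]lquot_piK -[v]lquot_piK -lquot_piD -!lquot_piZ.
by rewrite -lquot_piD scalerDr.
Qed.

Fact lquot_scaleDl w : {morph lquot_scale^~ w : a b / a + b}.
Proof.
by move=> a b; rewrite -[w]lquot_piK -!lquot_piZ -lquot_piD scalerDl.
Qed.

HB.instance Definition _ := GRing.Zmodule_isLmodule.Build R lquot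
  lquot_scaleA lquot_scale1 lquot_scaleDr lquot_scaleDl.

Fact lquot_pi_linear : linear lquot_pi.
Proof. by move=> a u v; rewrite lquot_piD lquot_piZ. Qed.

HB.instance Definition _ := GRing.isLinear.Build R V lquot *:%R lquot_pi
  lquot_pi_linear.

End LmodQuotient.

Section Kaehler.
Variables (k K : fieldType) (iota : {rmorphism k -> K}).

(* In {freeg K / K}, << x >> is the generator dx and << a *g x >> is a dx. *)
Inductive kaehler_rel : {freeg K / K} -> Prop :=
| KRel0 : kaehler_rel 0
| KRelP a u v : kaehler_rel u -> kaehler_rel v -> kaehler_rel (a *: u + v)
| KRelD x y : kaehler_rel (<< x + y >> - << x >> - << y >>)
| KRelM x y : kaehler_rel (<< x * y >> - << x *g y >> - << y *g x >>)
| KRelC c : kaehler_rel << iota c >>.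

Definition kaehler_relb : {pred {freeg K / K}} := fun u => `[< kaehler_rel u >].

Fact kaehler_rel_submod : submod_closed kaehler_relb.
Proof.
split=> [|a u v /asboolP hu /asboolP hv]; apply/asboolP; first exact: KRel0.
exact: KRelP.
Qed.

HB.instance Definition _ :=
  GRing.isSubmodClosed.Build K {freeg K / K} kaehler_relb kaehler_rel_submod.

Definition kaehler : lmodType K := lquot kaehler_relb.

Definition kd (x : K) : kaehler := lquot_pi kaehler_relb << x >>.

Lemma kaehler_pi_eq u v :
  kaehler_rel (u - v) -> lquot_pi kaehler_relb u = lquot_pi kaehler_relb v.
Proof. by move=> h; apply/lquot_piP/asboolP. Qed.

Lemma freegUZ (a b x : K) : a *: << b *g x >> = << a * b *g x >> :> {freeg K / K}.
Proof.
by apply/eqP/freeg_eqP => y; rewrite coeffZ !coeffU mulrA.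
Qed.

Lemma kdD x y : kd (x + y) = kd x + kd y.
Proof.
rewrite -raddfD; apply: kaehler_pi_eq; rewrite opprD addrA; exact: KRelD.
Qed.

Lemma kdM x y : kd (x * y) = x *: kd y + y *: kd x.
Proof.
rewrite -!linearZ -raddfD; apply: kaehler_pi_eq.
by rewrite !freegUZ !mulr1 opprD addrA; exact: KRelM.
Qed.

Lemma kdC c : kd (iota c) = 0.
Proof.
rewrite -(raddf0 (lquot_pi kaehler_relb)); apply: kaehler_pi_eq.
by rewrite subr0; exact: KRelC.
Qed.

Lemma kdB x y : kd (x - y) = kd x - kd y.
Proof. by apply/eqP; rewrite eq_sym subr_eq -kdD subrK. Qed.

End Kaehler.

Section KaehlerMap.
Variables (k K L : fieldType) (iK : {rmorphism k -> K}) (iL : {rmorphism k -> L}).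
Variable s : {rmorphism K -> L}.

Let phi (u : {freeg K / K}) : kaehler iL :=
  \sum_(x <- dom u) s (coeff x u) *: kd iL (s x).

(* The map a dx |-> s(a) d(s(x)); meaningful when s is a k-homomorphism. *)
Definition kaehler_map (w : kaehler iK) : kaehler iL := phi (repr w).

Hypothesis sC : forall c, s (iK c) = iL c.

Let phiE (r : seq K) u : uniq r -> (forall x, x \in dom u -> x \in r) ->
  phi u = \sum_(x <- r) s (coeff x u) *: kd iL (s x).
Proof.
move=> ur sur; rewrite /phi [RHS](bigID (mem (dom u))) /=.
rewrite [X in _ + X]big1 ?addr0; last first.
  by move=> x xu; rewrite coeff_outdom // rmorph0 scale0r.
rewrite -[RHS]big_filter; apply: perm_big; apply: uniq_perm.
- exact: uniq_dom.
- exact: filter_uniq.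
move=> x; rewrite mem_filter /=; apply/idP/andP => [xu|[] //].
by split=> //; apply: sur.
Qed.

Let phiP a u v : phi (a *: u + v) = s a *: phi u + phi v.
Proof.
pose r := undup (dom u ++ dom v ++ dom (a *: u + v)).
have ur : uniq r by exact: undup_uniq.
rewrite !(@phiE r) //; try by move=> x xu; rewrite mem_undup !mem_cat xu ?orbT.
rewrite scaler_sumr -big_split /=; apply: eq_bigr => x _.
by rewrite coeffD coeffZ rmorphD rmorphM scalerDl scalerA.
Qed.

Let phi0 : phi 0 = 0.
Proof. by rewrite /phi dom0 big_nil. Qed.

Let phiU a x : phi << a *g x >> = s a *: kd iL (s x).
Proof.
rewrite (@phiE [:: x]) //.
  by rewrite big_seq1 coeffU eqxx mulr1.
move=> y; rewrite mem_dom coeffU inE [y == x]eq_sym.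
by case: (x == y) => //; rewrite mulr0 eqxx.
Qed.

Let phiD u v : phi (u + v) = phi u + phi v.
Proof. by rewrite -{1}[u]scale1r phiP rmorph1 scale1r. Qed.

Let phiB u v : phi (u - v) = phi u - phi v.
Proof. by apply/eqP; rewrite eq_sym subr_eq -phiD subrK. Qed.

Let phi_rel u : kaehler_rel iK u -> phi u = 0.
Proof.
elim=> [|a {}u v _ hu _ hv|x y|x y|c].
- exact: phi0.
- by rewrite phiP hu hv scaler0 addr0.
- by rewrite !phiB !phiU !rmorph1 !scale1r rmorphD kdD -addrA -opprD subrr.
- rewrite !phiB !phiU !rmorph1 !scale1r rmorphM kdM.
  by rewrite -addrA -opprD subrr.
- by rewrite phiU sC kdC scaler0.
Qed.

Lemma kaehler_mapE u : kaehler_map (lquot_pi (kaehler_relb iK) u) = phi u.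
Proof.
apply/eqP; rewrite -subr_eq0 -phiB; apply/eqP/phi_rel/asboolP.
exact: (lquot_piP (kaehler_relb iK) _ _).1 (lquot_piK _).
Qed.

Lemma kaehler_mapP a w1 w2 :
  kaehler_map (a *: w1 + w2) = s a *: kaehler_map w1 + kaehler_map w2.
Proof.
rewrite -[w1]lquot_piK -[w2]lquot_piK -linearP !kaehler_mapE; exact: phiP.
Qed.

Lemma kaehler_mapD w1 w2 :
  kaehler_map (w1 + w2) = kaehler_map w1 + kaehler_map w2.
Proof. by rewrite -{1}[w1]scale1r kaehler_mapP rmorph1 scale1r. Qed.

Lemma kaehler_mapB w1 w2 :
  kaehler_map (w1 - w2) = kaehler_map w1 - kaehler_map w2.
Proof. by apply/eqP; rewrite eq_sym subr_eq -kaehler_mapD subrK. Qed.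

Lemma kaehler_map0 : kaehler_map 0 = 0.
Proof. by rewrite -(subrr 0) kaehler_mapB subrr. Qed.

Lemma kaehler_mapZ a w : kaehler_map (a *: w) = s a *: kaehler_map w.
Proof. by rewrite -[a *: w]addr0 kaehler_mapP kaehler_map0 addr0. Qed.

Lemma kaehler_map_d x : kaehler_map (kd iK x) = kd iL (s x).
Proof. by rewrite kaehler_mapE phiU rmorph1 scale1r. Qed.

End KaehlerMap.

(* An irreducible closed subvariety of projective n-space over the
   algebraically closed field k, given by its generic point: pv_fun is its
   function field, pv_gen the tuple of homogeneous coordinates of the generic
   point. Its homogeneous prime ideal is spanned by the homogeneous F with
   F(pv_gen) = 0, and pv_funP says that its rational functions are the
   quotients F/G of homogeneous polynomials of the same degree, G not in the
   ideal. Every homogeneous prime ideal other than the irrelevant one arises in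
   this way, from exactly one isomorphism class of pairs
   (pv_fun, pv_gen up to scaling). *)
Record proj_variety (k : closedFieldType) := ProjVariety {
  pv_n : nat;
  pv_fun : fieldType;
  pv_const : {rmorphism k -> pv_fun};
  pv_gen : 'I_pv_n.+1 -> pv_fun;
  pv_gen_neq0 : exists i, pv_gen i != 0;
  pv_funP : forall z : pv_fun, exists d (F G : {mpoly k[pv_n.+1]}),
    [/\ F \is d.-homog, G \is d.-homog, mmap pv_const pv_gen G != 0
      & z = mmap pv_const pv_gen F / mmap pv_const pv_gen G]
}.

Section Variety.
Variables (k : closedFieldType) (X : proj_variety k).
Local Notation n := (pv_n X).
Local Notation K := (pv_fun X).
Local Notation iota := (pv_const X).

Definition pv_eval (F : {mpoly k[n.+1]}) : K := mmap iota (@pv_gen k X) F.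

(* A k-point of projective space is represented by its unique homogeneous
   coordinate vector whose first nonzero entry is 1. *)
Definition normalized (v : 'rV[k]_n.+1) : bool :=
  [exists i, (v 0 i == 1) && [forall j : 'I_n.+1, (j < i)%N ==> (v 0 j == 0)]].

Definition on_variety (v : 'rV[k]_n.+1) : bool :=
  normalized v && `[< forall d (F : {mpoly k[n.+1]}),
    F \is d.-homog -> pv_eval F = 0 -> F.@[fun i => v 0 i] = 0 >].

Definition point : Type := {v : 'rV[k]_n.+1 | on_variety v}.

Definition pt_eval (P : point) (F : {mpoly k[n.+1]}) : k :=
  F.@[fun i => val P 0 i].

(* The rational function z is regular at P, with value c. *)
Definition value_at (P : point) (z : K) (c : k) : Prop :=
  exists d (F G : {mpoly k[n.+1]}),
    [/\ F \is d.-homog, G \is d.-homog, pt_eval P G != 0,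
        z = pv_eval F / pv_eval G & c = pt_eval P F / pt_eval P G].

(* The local ring at P and its maximal ideal, as subsets of K. *)
Definition local_ring (P : point) : set K := [set z | exists c, value_at P z c].
Definition max_ideal (P : point) : set K := [set z | value_at P z 0].

Definition zariski_open (U : set point) : Prop :=
  exists S : set {mpoly k[n.+1]},
    (forall F, S F -> exists d, F \is d.-homog) /\
    U = [set P | exists2 F, S F & pt_eval P F != 0].

Definition alg_indep d (t : 'I_d -> K) : Prop :=
  forall F : {mpoly k[d]}, mmap iota t F = 0 -> F = 0.

(* dim X is the transcendence degree of the function field. *)
Definition has_dim (d : nat) : Prop :=
  (exists t : 'I_d -> K, alg_indep t) /\
  (forall t : 'I_d.+1 -> K, ~ alg_indep t).

(* Over an algebraically closed field a variety is smooth iff its local rings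
   at closed points are regular; these have Krull dimension d = dim X, and are
   regular when the maximal ideal is generated by d elements. *)
Definition smooth_of_dim (d : nat) : Prop :=
  has_dim d /\
  forall P, exists t : 'I_d -> K,
    (forall i, max_ideal P (t i)) /\
    (forall z, max_ideal P z -> exists a : 'I_d -> K,
       (forall i, local_ring P (a i)) /\ z = \sum_i a i * t i).

(* Projectivity and irreducibility are part of proj_variety. *)
Definition smooth_curve : Prop := smooth_of_dim 1.

(* The rational differential w belongs to the image of the differentials of
   the local ring at P; at a smooth point those embed into the rational ones. *)
Definition dregular (P : point) (w : kaehler iota) : Prop :=
  exists m (a b : 'I_m -> K),
    (forall i, local_ring P (a i) /\ local_ring P (b i)) /\
    w = \sum_i a i *: kd iota (b i).

(* g = dim_k H^0(X, Omega): some family of g global regular differentials is a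
   k-basis of all of them. *)
Definition has_genus (g : nat) : Prop :=
  exists w : 'I_g -> kaehler iota,
    (forall i P, dregular P (w i)) /\
    (forall v, (forall P, dregular P v) ->
       exists! c : {ffun 'I_g -> k}, v = \sum_i iota (c i) *: w i).

Lemma pv_eval_neq0 P d (G : {mpoly k[n.+1]}) :
  G \is d.-homog -> pt_eval P G != 0 -> pv_eval G != 0.
Proof.
move=> hG; apply: contra => /eqP G0; have /andP[_ /asboolP hP] := valP P.
exact/eqP/(hP _ _ hG).
Qed.

Lemma local_ringC P c : local_ring P (iota c).
Proof.
exists c; exists 0%N, c%:MP, 1; split.
- apply/dhomogP => m; rewrite msuppC; case: (c == 0) => //.
  by rewrite inE => /eqP ->; exact: mdeg0.
- exact: dhomog1.
- by rewrite /pt_eval rmorph1 oner_neq0.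
- by rewrite /pv_eval rmorph1 mmapC divr1.
- by rewrite /pt_eval rmorph1 mevalC divr1.
Qed.

Lemma local_ringD P x y :
  local_ring P x -> local_ring P y -> local_ring P (x + y).
Proof.
move=> [c [d [F [G [hF hG G0 -> _]]]]] [c' [e [F' [G' [hF' hG' G'0 -> _]]]]].
exists (pt_eval P (F * G' + F' * G) / pt_eval P (G * G')).
exists (d + e)%N, (F * G' + F' * G), (G * G'); split=> //.
- by apply: rpredD; [|rewrite addnC]; exact: dhomogM.
- exact: dhomogM.
- by rewrite /pt_eval mevalM mulf_neq0.
- have := pv_eval_neq0 hG G0; have := pv_eval_neq0 hG' G'0.
  by rewrite /pv_eval rmorphD !rmorphM => ? ?; rewrite addf_div.
Qed.

Lemma local_ringM P x y :
  local_ring P x -> local_ring P y -> local_ring P (x * y).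
Proof.
move=> [c [d [F [G [hF hG G0 -> _]]]]] [c' [e [F' [G' [hF' hG' G'0 -> _]]]]].
exists (pt_eval P (F * F') / pt_eval P (G * G')).
exists (d + e)%N, (F * F'), (G * G'); split; rewrite ?dhomogM //.
- by rewrite /pt_eval mevalM mulf_neq0.
- by rewrite /pv_eval !rmorphM mulf_div.
Qed.

Lemma dregularD P v w : dregular P v -> dregular P w -> dregular P (v + w).
Proof.
move=> [m [a [b [hab ->]]]] [m' [a' [b' [hab' ->]]]].
exists (m + m')%N.
exists (fun i => match fintype.split i with inl j => a j | inr j => a' j end).
exists (fun i => match fintype.split i with inl j => b j | inr j => b' j end).
split=> [i|]; first by case: (fintype.split i).
rewrite big_split_ord /=; congr (_ + _); apply: eq_bigr => i _.
  by rewrite (unsplitK (inl i)).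
by rewrite (unsplitK (inr i)).
Qed.

Lemma dregularZ P c w : dregular P w -> dregular P (iota c *: w).
Proof.
move=> [m [a [b [hab ->]]]]; exists m, (fun i => iota c * a i), b; split.
  move=> i; have [? ?] := hab i; split=> //.
  by apply: local_ringM => //; exact: local_ringC.
by rewrite scaler_sumr; apply: eq_bigr => i _; rewrite scalerA.
Qed.

Lemma zariski_openI U V :
  zariski_open U -> zariski_open V -> zariski_open (U `&` V).
Proof.
move=> [S [hS ->]] [T [hT ->]].
exists [set H | exists F G, [/\ S F, T G & H = F * G]]; split.
  move=> _ [F [G [/hS[d hF] /hT[e hG] ->]]]; exists (d + e)%N; exact: dhomogM.
apply/seteqP; split=> P /=.
  move=> [[F SF F0] [G TG G0]]; exists (F * G); first by exists F, G.
  by rewrite /pt_eval mevalM mulf_neq0.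
move=> [_ [F [G [SF TG ->]]]]; rewrite /pt_eval mevalM mulf_eq0 negb_or.
by move=> /andP[F0 G0]; split; [exists F|exists G].
Qed.

Lemma zariski_openT : zariski_open setT.
Proof.
exists [set 1]; split; first by move=> _ ->; exists 0%N; exact: dhomog1.
apply/seteqP; split=> P //= _; exists 1 => //.
by rewrite /pt_eval rmorph1 oner_neq0.
Qed.

(* First hypercohomology of O_X -> Omega_X, as the direct limit over all open
   coverings of the Cech hypercohomology. Coverings (U_x) indexed by the points
   x of X, with x in U_x, are cofinal, and the refinement maps between them can
   be taken to be restrictions. As X is irreducible, sections over nonempty open
   sets are elements of the function field (resp. of its differentials) and
   restriction maps are inclusions, so that the limit is the quotient of the
   union of the cocycle spaces by the union of the coboundary spaces. The first
   component of a cochain is a 1-cochain of O_X, the second one is a 0-cochain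
   of Omega_X. *)
Definition hypercochain : Type :=
  ((point -> point -> K) * (point -> kaehler iota))%type.

HB.instance Definition _ := Choice.on hypercochain.
HB.instance Definition _ := GRing.Zmodule.on hypercochain.

Definition hscale (a : k) (c : hypercochain) : hypercochain :=
  (fun x y => iota a * c.1 x y, fun x => iota a *: c.2 x).

Let hcE (c c' : hypercochain) : (forall x y, c.1 x y = c'.1 x y) ->
  (forall x, c.2 x = c'.2 x) -> c = c'.
Proof.
case: c c' => [f w] [f' w'] /= h1 h2; congr pair; last exact/funext.
by apply/funext => x; apply/funext => y.
Qed.

Fact hscaleA a b c : hscale a (hscale b c) = hscale (a * b) c.
Proof. by apply: hcE => [x y|x] /=; rewrite rmorphM ?mulrA ?scalerA. Qed.

Fact hscale1 : left_id 1 hscale.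
Proof. by move=> c; apply: hcE => [x y|x] /=; rewrite rmorph1 ?mul1r ?scale1r. Qed.

Fact hscaleDr : right_distributive hscale +%R.
Proof. by move=> a c c'; apply: hcE => [x y|x] /=; rewrite ?mulrDr ?scalerDr. Qed.

Fact hscaleDl c : {morph hscale^~ c : a b / a + b}.
Proof.
by move=> a b; apply: hcE => [x y|x] /=; rewrite rmorphD ?mulrDl ?scalerDl.
Qed.

HB.instance Definition _ := GRing.Zmodule_isLmodule.Build k hypercochain
  hscaleA hscale1 hscaleDr hscaleDl.

Definition is_cover (U : point -> set point) : Prop :=
  forall x, zariski_open (U x) /\ U x x.

Definition is_hypercocycle (c : hypercochain) : Prop :=
  exists U, [/\ is_cover U,
    forall x y P, U x P -> U y P -> local_ring P (c.1 x y),
    forall x P, U x P -> dregular P (c.2 x),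
    forall x y z, c.1 x z = c.1 x y + c.1 y z
  & forall x y, kd iota (c.1 x y) = c.2 y - c.2 x].

Definition is_hypercoboundary (c : hypercochain) : Prop :=
  exists U (h : point -> K), [/\ is_cover U,
    forall x P, U x P -> local_ring P (h x),
    forall x y, c.1 x y = h y - h x
  & forall x, c.2 x = kd iota (h x)].

Definition hypercocycleb : {pred hypercochain} :=
  fun c => `[< is_hypercocycle c >].

Lemma is_coverI U V : is_cover U -> is_cover V -> is_cover (fun x => U x `&` V x).
Proof.
move=> hU hV x; have [? ?] := hU x; have [? ?] := hV x.
by split=> //; exact: zariski_openI.
Qed.

Lemma is_coverT : is_cover (fun=> setT).
Proof. by move=> x; split=> //; exact: zariski_openT. Qed.

Lemma kdZ (a : k) z : kd iota (iota a * z) = iota a *: kd iota z.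
Proof. by rewrite kdM kdC scaler0 addr0. Qed.

Fact hypercocycle_submod : submod_closed hypercocycleb.
Proof.
split=> [|a c c' /asboolP hc /asboolP hc']; apply/asboolP.
  exists (fun=> setT); split=> //=.
  - exact: is_coverT.
  - move=> x y P _ _; change (local_ring P 0).
    by rewrite -(rmorph0 iota); exact: local_ringC.
  - move=> x P _; exists 0%N, (fun=> 0), (fun=> 0); split; first by case.
    by rewrite big_ord0.
  - by move=> x y z; change (0 = 0 + 0 :> K); rewrite addr0.
  - move=> x y; change (kd iota 0 = 0 - 0).
    by rewrite -(rmorph0 iota) kdC subr0.
have [U [hU1 hU2 hU3 hU4 hU5]] := hc; have [V [hV1 hV2 hV3 hV4 hV5]] := hc'.
exists (fun x => U x `&` V x); split=> /=.
- exact: is_coverI.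
- move=> x y P [? ?] [? ?]; apply: local_ringD; last exact: hV2.
  by apply: local_ringM; [exact: local_ringC|exact: hU2].
- move=> x P [? ?]; apply: dregularD; last exact: hV3.
  by apply: dregularZ; exact: hU3.
- move=> x y z; change (iota a * c.1 x z + c'.1 x z =
    iota a * c.1 x y + c'.1 x y + (iota a * c.1 y z + c'.1 y z)).
  by rewrite (hU4 x y z) (hV4 x y z) mulrDr addrACA.
- move=> x y; change (kd iota (iota a * c.1 x y + c'.1 x y) =
    iota a *: c.2 y + c'.2 y - (iota a *: c.2 x + c'.2 x)).
  by rewrite kdD kdZ hU5 hV5 scalerBr opprD addrACA.
Qed.

HB.instance Definition _ :=
  GRing.isSubmodClosed.Build k hypercochain hypercocycleb hypercocycle_submod.

Definition hypercocycle : Type := {c : hypercochain | hypercocycleb c}.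

HB.instance Definition _ := SubChoice.on hypercocycle.
HB.instance Definition _ := [SubChoice_isSubZmodule of hypercocycle by <:].
HB.instance Definition _ := [SubZmodule_isSubLmodule of hypercocycle by <:].

Definition hypercoboundaryb : {pred hypercocycle} :=
  fun c => `[< is_hypercoboundary (val c) >].

Fact hypercoboundary_submod : submod_closed hypercoboundaryb.
Proof.
split=> [|a c c' /asboolP hc /asboolP hc']; apply/asboolP.
  rewrite raddf0; exists (fun=> setT), (fun=> 0); split=> //=.
  - exact: is_coverT.
  - by move=> x P _; rewrite -(rmorph0 iota); exact: local_ringC.
  - by move=> x y; rewrite subr0.
  - by move=> x; rewrite -(rmorph0 iota) kdC.
have [U [h [hU1 hU2 hU3 hU4]]] := hc; have [V [h' [hV1 hV2 hV3 hV4]]] := hc'.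
rewrite linearP; exists (fun x => U x `&` V x), (fun x => iota a * h x + h' x).
split=> /=.
- exact: is_coverI.
- move=> x P [? ?]; apply: local_ringD; last exact: hV2.
  by apply: local_ringM; [exact: local_ringC|exact: hU2].
- move=> x y; change (iota a * (val c).1 x y + (val c').1 x y =
    iota a * h y + h' y - (iota a * h x + h' x)).
  by rewrite hU3 hV3 mulrBr opprD addrACA.
- move=> x; change (iota a *: (val c).2 x + (val c').2 x =
    kd iota (iota a * h x + h' x)).
  by rewrite kdD kdZ hU4 hV4.
Qed.

HB.instance Definition _ :=
  GRing.isSubmodClosed.Build k hypercocycle hypercoboundaryb hypercoboundary_submod.

Definition H1dR : lmodType k := lquot hypercoboundaryb.

End Variety.

(* Dominant morphisms: a continuous map on points together with its comorphism
   on function fields, such that the pull-back of a function regular at f(P) is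
   regular at P and is given there by composition with f. *)
Record dominant_morphism (k : closedFieldType) (X Y : proj_variety k) :=
  DominantMorphism {
  dm_pt :> point X -> point Y;
  dm_fun : {rmorphism pv_fun Y -> pv_fun X};
  dm_const : forall c, dm_fun (pv_const Y c) = pv_const X c;
  dm_cont : forall V, zariski_open V -> zariski_open (dm_pt @^-1` V);
  dm_reg : forall P z c, value_at (dm_pt P) z c -> value_at P (dm_fun z) c
}.

Section Morphisms.
Variable k : closedFieldType.
Implicit Types X Y : proj_variety k.

Definition dm_eq X Y (f g : dominant_morphism X Y) : Prop :=
  dm_pt f =1 dm_pt g /\ dm_fun f =1 dm_fun g.

Definition dm_id X : dominant_morphism X X :=
  @DominantMorphism k X X id idfun
    (fun=> erefl) (fun V hV => hV) (fun P z c h => h).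

Section Comp.
Variables (X Y Z : proj_variety k).
Variables (g : dominant_morphism Y Z) (f : dominant_morphism X Y).

Let pt : point X -> point Z := dm_pt g \o dm_pt f.
Let fn : {rmorphism pv_fun Z -> pv_fun X} := dm_fun f \o dm_fun g.

Fact dm_comp_const c : fn (pv_const Z c) = pv_const X c.
Proof. by rewrite /fn /= !dm_const. Qed.

Fact dm_comp_cont V : zariski_open V -> zariski_open (pt @^-1` V).
Proof. by move=> hV; rewrite /pt comp_preimage; exact/dm_cont/dm_cont. Qed.

Fact dm_comp_reg P z c : value_at (pt P) z c -> value_at P (fn z) c.
Proof. by move=> h; apply: dm_reg; apply: dm_reg. Qed.

Definition dm_comp : dominant_morphism X Z :=
  DominantMorphism dm_comp_const dm_comp_cont dm_comp_reg.

End Comp.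

Definition is_automorphism X (s : dominant_morphism X X) : Prop :=
  exists t : dominant_morphism X X,
    dm_eq (dm_comp s t) (dm_id X) /\ dm_eq (dm_comp t s) (dm_id X).

(* [K(X) : K(Y)] = m. A dominant morphism between projective curves is finite,
   so finiteness is not imposed separately. *)
Definition has_degree X Y (f : dominant_morphism X Y) (m : nat) : Prop :=
  exists e : 'I_m -> pv_fun X, forall z,
    exists! c : {ffun 'I_m -> pv_fun Y}, z = \sum_i dm_fun f (c i) * e i.

Definition separable_morphism X Y (f : dominant_morphism X Y) : Prop :=
  forall z : pv_fun X, exists q : {poly pv_fun Y},
    separable_poly q /\ root (map_poly (dm_fun f) q) z.

End Morphisms.

Section Pullback.
Variables (k : closedFieldType) (X Y : proj_variety k).
Variable f : dominant_morphism X Y.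

Definition hpull (c : hypercochain Y) : hypercochain X :=
  (fun x y => dm_fun f (c.1 (f x) (f y)),
   fun x => kaehler_map (pv_const X) (dm_fun f) (c.2 (f x))).

Lemma local_ring_pull P z : local_ring (f P) z -> local_ring P (dm_fun f z).
Proof. by move=> [c hc]; exists c; exact: dm_reg. Qed.

Lemma kaehler_map_sum m (w : 'I_m -> kaehler (pv_const Y)) :
  kaehler_map (pv_const X) (dm_fun f) (\sum_i w i) =
  \sum_i kaehler_map (pv_const X) (dm_fun f) (w i).
Proof.
apply: (big_morph (kaehler_map (pv_const X) (dm_fun f))).
  by move=> x y; apply: kaehler_mapD; exact: dm_const.
by apply: kaehler_map0; exact: dm_const.
Qed.

Lemma dregular_pull P w : dregular (f P) w ->
  dregular P (kaehler_map (pv_const X) (dm_fun f) w).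
Proof.
move=> [m [a [b [hab ->]]]].
exists m, (fun i => dm_fun f (a i)), (fun i => dm_fun f (b i)); split.
  by move=> i; have [? ?] := hab i; split; exact: local_ring_pull.
rewrite kaehler_map_sum; apply: eq_bigr => i _.
rewrite kaehler_mapZ ?kaehler_map_d //; exact: dm_const.
Qed.

Lemma is_cover_pull U : is_cover U -> is_cover (fun x => f @^-1` (U (f x))).
Proof. by move=> hU x; have [? ?] := hU (f x); split=> //; exact: dm_cont. Qed.

Lemma hpull_cocycle c : is_hypercocycle c -> is_hypercocycle (hpull c).
Proof.
move=> [U [h1 h2 h3 h4 h5]]; exists (fun x => f @^-1` (U (f x))); split=> /=.
- exact: is_cover_pull.
- by move=> x y P ? ?; apply: local_ring_pull; exact: h2.
- by move=> x P ?; apply: dregular_pull; exact: h3.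
- by move=> x y z; rewrite -rmorphD -h4.
- move=> x y; rewrite -kaehler_mapB -?h5 ?kaehler_map_d //; exact: dm_const.
Qed.

Lemma hpull_coboundary c : is_hypercoboundary c -> is_hypercoboundary (hpull c).
Proof.
move=> [U [h [h1 h2 h3 h4]]].
exists (fun x => f @^-1` (U (f x))), (fun x => dm_fun f (h (f x))); split=> /=.
- exact: is_cover_pull.
- by move=> x P ?; apply: local_ring_pull; exact: h2.
- by move=> x y; rewrite h3 rmorphB.
- move=> x; rewrite h4 kaehler_map_d //; exact: dm_const.
Qed.

Lemma hpull_linear : linear hpull.
Proof.
move=> a c c'; congr pair.
  apply/funext => x; apply/funext => y /=.
  change (dm_fun f (pv_const Y a * c.1 (f x) (f y) + c'.1 (f x) (f y)) =
    pv_const X a * dm_fun f (c.1 (f x) (f y)) + dm_fun f (c'.1 (f x) (f y))).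
  by rewrite rmorphD rmorphM dm_const.
apply/funext => x /=.
change (kaehler_map (pv_const X) (dm_fun f)
    (pv_const Y a *: c.2 (f x) + c'.2 (f x)) =
  pv_const X a *: kaehler_map (pv_const X) (dm_fun f) (c.2 (f x)) +
  kaehler_map (pv_const X) (dm_fun f) (c'.2 (f x))).
by rewrite kaehler_mapP ?dm_const //; exact: dm_const.
Qed.

Fact hpull_subproof (c : hypercocycle Y) : hypercocycleb (hpull (val c)).
Proof. by have /asboolP h := valP c; apply/asboolP/hpull_cocycle. Qed.

Definition cocycle_pull (c : hypercocycle Y) : hypercocycle X :=
  exist _ (hpull (val c)) (hpull_subproof c).

Definition H1dR_pull (c : H1dR Y) : H1dR X :=
  lquot_pi (@hypercoboundaryb k X) (cocycle_pull (repr c)).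

Lemma cocycle_pull_linear : linear cocycle_pull.
Proof.
move=> a c c'; apply: val_inj.
have e : val (a *: c + c') = a *: val c + val c' by exact: linearP.
rewrite [LHS](congr1 hpull e) hpull_linear; symmetry; exact: linearP.
Qed.

Lemma H1dR_pullE c :
  H1dR_pull (lquot_pi (@hypercoboundaryb k Y) c) =
  lquot_pi (@hypercoboundaryb k X) (cocycle_pull c).
Proof.
apply/lquot_piP; set r := repr _.
have /lquot_piP /asboolP h : lquot_pi (@hypercoboundaryb k Y) r =
  lquot_pi (@hypercoboundaryb k Y) c by exact: lquot_piK.
apply/asboolP.
have -> : cocycle_pull r - cocycle_pull c = cocycle_pull (r - c).
  rewrite [r - c]addrC -[- c]scaleN1r cocycle_pull_linear scaleN1r.
  by rewrite addrC.
exact: hpull_coboundary.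
Qed.

Lemma H1dR_pull_linear : linear H1dR_pull.
Proof.
move=> a c c'; rewrite -[c]lquot_piK -[c']lquot_piK -linearP !H1dR_pullE.
by rewrite cocycle_pull_linear linearP.
Qed.

HB.instance Definition _ :=
  GRing.isLinear.Build k (H1dR Y) (H1dR X) *:%R H1dR_pull H1dR_pull_linear.

End Pullback.

Section ProjectiveLine.
Variable k : closedFieldType.
Local Notation tofr := (@FracField.tofrac {poly k}).

Definition P1_const : {rmorphism k -> {fraction {poly k}}} :=
  tofr \o (@polyC k).

(* The generic point (1 : 'X). *)
Definition P1_gen (i : 'I_2) : {fraction {poly k}} :=
  tofr 'X^i.

Let hom (d : nat) (p : {poly k}) : {mpoly k[2]} :=
  \sum_(i < d.+1) p`_i *: ('X_ord0 ^+ (d - i) * 'X_ord_max ^+ i).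

Let hom_homog d p : hom d p \is d.-homog.
Proof.
apply: rpred_sum => i _; apply: rpredZ.
have hX (j : 'I_2) : ('X_j : {mpoly k[2]}) \is 1.-homog 
  by rewrite dhomogX; apply/eqP; exact: mdeg1.
have := dhomogM (dhomogMn (d - i) (hX ord0)) (dhomogMn i (hX ord_max)).
by rewrite !mul1n subnK // -ltnS.
Qed.

Let hom_eval d (p : {poly k}) : (size p <= d.+1)%N ->
  mmap P1_const P1_gen (hom d p) = tofr p.
Proof.
move=> sp; rewrite {2}(_ : p = \sum_(i < d.+1) p`_i *: 'X^i); last first.
  by rewrite -poly_def; apply/polyP => i; rewrite coef_poly; case: ltnP => // h;
     rewrite nth_default // (leq_trans sp).
rewrite !rmorph_sum; apply: eq_bigr => i _.
rewrite -mul_mpolyC !rmorphM !rmorphXn /= mmapC !mmapX !mmap1U /P1_gen /=.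
by rewrite expr0 rmorph1 expr1n mul1r expr1 -mul_polyC rmorphM rmorphXn.
Qed.

Fact P1_gen_neq0 : exists i, P1_gen i != 0.
Proof. by exists ord0; rewrite /P1_gen expr0 rmorph1 oner_neq0. Qed.

Fact P1_funP (z : {fraction {poly k}}) : exists d (F G : {mpoly k[2]}),
  [/\ F \is d.-homog, G \is d.-homog, mmap P1_const P1_gen G != 0
    & z = mmap P1_const P1_gen F / mmap P1_const P1_gen G].
Proof.
pose p := (\n_(repr z))%R; pose q := (\d_(repr z))%R.
have q0 : tofr q != 0 by rewrite tofrac_eq0 denom_ratioP.
have ez : z = tofr p / tofr q.
  apply: (canRL (mulfK q0)); rewrite -{1}[z]reprK; unlock FracField.tofrac.
  have d0 : \d_(repr z) * 1 != 0 by rewrite mulr1 denom_ratioP.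
  rewrite -[LHS]FracField.pi_mul; apply/eqmodP.
  rewrite /= FracField.equivfE /FracField.mulf !numden_Ratio ?oner_eq0 //.
  by rewrite !mulr1 mulrC.
pose d := maxn (size p) (size q).
have sp : (size p <= d.+1)%N by rewrite leqW // leq_maxl.
have sq : (size q <= d.+1)%N by rewrite leqW // leq_maxr.
exists d, (hom d p), (hom d q).
split; try exact: hom_homog.
  by rewrite hom_eval.
by rewrite !hom_eval.
Qed.

Definition P1 : proj_variety k :=
  @ProjVariety k 1 {fraction {poly k}} P1_const P1_gen P1_gen_neq0 P1_funP.

End ProjectiveLine.

(* Main.v *)
From HB Require Import structures.
From mathcomp Require Import all_boot all_order all_algebra.
From mathcomp Require Import boolp classical_sets functions.
From mathcomp Require Import freeg mpoly ring.
Require Import Defs.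

(* Write K = k(X), F = k(P^1), s for the comorphism of the involution sigma.
   One has 1 + sigma^* = pi^* Tr with Tr : H^1_dR(X) -> H^1_dR(P^1) = 0, in every
   characteristic. Concretely, a hypercocycle is a family c_P in K together with
   a rational form eta such that eta + d c_P is regular at P. Choose c_Q in K
   approximating c_P at the points P over Q, and h in F with Tr c_Q - h regular
   at Q for all Q (Mittag-Leffler on P^1). Then Tr eta + dh is regular on P^1
   because traces of regular forms are regular, so it vanishes, and
   P |-> c_P + s c_{sigma P} - h is a 0-cochain with boundary c + sigma^* c.

   Local rings of X are valuation rings because two elements of K are
   algebraically dependent. Surjectivity of pi and the nonvanishing of dt for a
   coordinate t of P^1 come from the genus: a point Q outside the image would give
   a nonconstant f regular on X, and the forms f^n w, for a regular form w != 0,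
   would be linearly independent. *)

Set Implicit Arguments.
Unset Strict Implicit.
Unset Printing Implicit Defensive.

Import GRing.Theory.
Local Open Scope ring_scope.
Local Open Scope classical_set_scope.

(** * Values of rational functions at points *)

Section Values.
Variables (k : closedFieldType) (X : proj_variety k).
Local Notation n := (pv_n X).
Local Notation K := (pv_fun X).
Local Notation iota := (pv_const X).
Implicit Types (P : point X) (z w : K) (a b c : k).

Lemma value_at_uniq P z c c' : value_at P z c -> value_at P z c' -> c = c'.
Proof.
move=> [d [F [G [hF hG G0 -> ->]]]] [d' [F' [G' [hF' hG' G'0 e ->]]]].
have hE : pv_eval (F * G' - F' * G) = 0.
  move/eqP: e; rewrite (eqr_div _ _ (pv_eval_neq0 hG G0) (pv_eval_neq0 hG' G'0)).
  by move/eqP => e; rewrite /pv_eval rmorphB !rmorphM /= -!/(pv_eval _) e subrr.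
have hH : F * G' - F' * G \is (d + d').-homog.
  by apply: rpredB; [|rewrite addnC]; exact: dhomogM.
have /andP[_ /asboolP hP] := valP P.
have := hP _ _ hH hE; rewrite mevalB !mevalM => /eqP.
by rewrite subr_eq0 => /eqP e'; apply/eqP; rewrite eqr_div //; apply/eqP.
Qed.

Lemma value_atC P c : value_at P (iota c) c.
Proof.
exists 0%N, c%:MP, 1; split.
- by apply/dhomogP => m; rewrite msuppC; case: (c == 0) => //;
     rewrite inE => /eqP ->; exact: mdeg0.
- exact: dhomog1.
- by rewrite /pt_eval rmorph1 oner_neq0.
- by rewrite /pv_eval rmorph1 mmapC divr1.
- by rewrite /pt_eval rmorph1 mevalC divr1.
Qed.

Lemma value_atD P z w a b :
  value_at P z a -> value_at P w b -> value_at P (z + w) (a + b).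
Proof.
move=> [d [F [G [hF hG G0 -> ->]]]] [e [F' [G' [hF' hG' G'0 -> ->]]]].
exists (d + e)%N, (F * G' + F' * G), (G * G'); split=> //.
- by apply: rpredD; [|rewrite addnC]; exact: dhomogM.
- exact: dhomogM.
- by rewrite /pt_eval mevalM mulf_neq0.
- have := pv_eval_neq0 hG G0; have := pv_eval_neq0 hG' G'0.
  by rewrite /pv_eval rmorphD !rmorphM => ? ?; rewrite addf_div.
- by rewrite /pt_eval mevalD !mevalM addf_div.
Qed.

Lemma value_atM P z w a b :
  value_at P z a -> value_at P w b -> value_at P (z * w) (a * b).
Proof.
move=> [d [F [G [hF hG G0 -> ->]]]] [e [F' [G' [hF' hG' G'0 -> ->]]]].
exists (d + e)%N, (F * F'), (G * G'); split=> //.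
- exact: dhomogM.
- exact: dhomogM.
- by rewrite /pt_eval mevalM mulf_neq0.
- by rewrite /pv_eval !rmorphM mulf_div.
- by rewrite /pt_eval !mevalM mulf_div.
Qed.

Lemma value_at0 P : value_at P 0 0.
Proof. by rewrite -(rmorph0 iota); exact: value_atC. Qed.

Lemma value_at1 P : value_at P 1 1.
Proof. by rewrite -(rmorph1 iota); exact: value_atC. Qed.

Lemma value_atN P z a : value_at P z a -> value_at P (- z) (- a).
Proof.
move=> h; rewrite -mulN1r -[- a]mulN1r.
by apply: value_atM => //; rewrite -(rmorphN1 iota); exact: value_atC.
Qed.

Lemma value_atB P z w a b :
  value_at P z a -> value_at P w b -> value_at P (z - w) (a - b).
Proof. by move=> hz hw; apply: value_atD => //; exact: value_atN. Qed.

Lemma value_atV P z a : a != 0 -> value_at P z a -> value_at P z^-1 a^-1.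
Proof.
move=> a0 [d [F [G [hF hG G0 -> e]]]]; exists d, G, F; split=> //.
- by apply: contraNneq a0 => F0; rewrite e F0 mul0r.
- by rewrite invf_div.
- by rewrite e invf_div.
Qed.

Lemma value_at_neq0 P z a : a != 0 -> value_at P z a -> z != 0.
Proof.
move=> a0 h; apply: contraNneq a0 => z0; rewrite z0 in h.
by rewrite (value_at_uniq h (value_at0 P)).
Qed.

Lemma value_atX P z a m : value_at P z a -> value_at P (z ^+ m) (a ^+ m).
Proof.
move=> h; elim: m => [|m IH]; first by rewrite !expr0; exact: value_at1.
by rewrite !exprS; exact: value_atM.
Qed.

Lemma value_atM0 P z w : local_ring P z -> value_at P w 0 -> value_at P (z * w) 0.
Proof. by move=> [c hz] hw; rewrite -(mulr0 c); exact: value_atM. Qed.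

Lemma local_ring0 P : local_ring P 0. Proof. by exists 0; exact: value_at0. Qed.
Lemma local_ring1 P : local_ring P 1. Proof. by exists 1; exact: value_at1. Qed.

Lemma local_ringB P z w : local_ring P z -> local_ring P w -> local_ring P (z - w).
Proof. by move=> [a ha] [b hb]; exists (a - b); exact: value_atB. Qed.

Lemma local_ringN P z : local_ring P z -> local_ring P (- z).
Proof. by move=> [a ha]; exists (- a); exact: value_atN. Qed.

Lemma local_ringX P z m : local_ring P z -> local_ring P (z ^+ m).
Proof. by move=> [a ha]; exists (a ^+ m); exact: value_atX. Qed.

Lemma local_ring_sum P I (r : seq I) (Q : pred I) (f : I -> K) :
  (forall i, Q i -> local_ring P (f i)) -> local_ring P (\sum_(i <- r | Q i) f i).
Proof.
move=> h; elim/big_rec: _ => [|i x Qi hx]; first exact: local_ring0.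
by apply: local_ringD => //; exact: h.
Qed.

Lemma local_ring_zariski_open z : zariski_open [set P | local_ring P z].
Proof.
exists [set G | exists d F, [/\ F \is d.-homog, G \is d.-homog
  & pv_eval G != 0 /\ z = pv_eval F / pv_eval G]]; split.
  by move=> G /= [d [F [_ hG _]]]; exists d.
apply/seteqP; split=> P /=.
  move=> [c [d [F [G [hF hG G0 ? _]]]]]; exists G => //; exists d, F; split=> //.
  by split=> //; exact: pv_eval_neq0 hG G0.
move=> [G [d [F [hF hG [_ ?]]]] G0]; exists (pt_eval P F / pt_eval P G), d, F, G.
by split.
Qed.

(** * Points, linear forms and separation of points *)

Lemma normalizedP P : exists2 i, val P 0 i = 1 &
  forall j : 'I_n.+1, (j < i)%N -> val P 0 j = 0.
Proof.
have /andP[/existsP[i /andP[/eqP e /forallP h]] _] := valP P.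
by exists i => // j ji; apply/eqP; move: (h j); rewrite ji.
Qed.

(** [P'] has a nonzero entry, so the factor is nonzero. The first nonzero entries of both vectors
    then have the same index, and both being 1 forces the factor to be 1. *)
Lemma normalized_prop P P' (i : 'I_n.+1) :
  (forall j, val P' 0 j = val P' 0 i * val P 0 j) -> P = P'.
Proof.
move=> h; set a := val P' 0 i in h.
have a0 : a != 0.
  have [m e _] := normalizedP P'; apply/eqP => a0.
  by move: e; rewrite h a0 mul0r => /eqP; rewrite eq_sym oner_eq0.
have [m e em] := normalizedP P; have [m' e' em'] := normalizedP P'.
have mm' : m = m' :> nat.
  case: (ltngtP m m') => // lt.
    by move/eqP: (em' _ lt); rewrite h e mulr1 (negPf a0).
  by move/eqP: (e'); rewrite h (em _ lt) mulr0 eq_sym oner_eq0.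
have a1 : a = 1 by move: e'; rewrite h -(ord_inj mm') e mulr1.
by apply/val_inj/rowP => j; rewrite h a1 mul1r.
Qed.

Lemma dhomogXi i : ('X_i : {mpoly k[n.+1]}) \is 1.-homog.
Proof. by rewrite dhomogX; apply/eqP; exact: mdeg1. Qed.

(** Numerator and denominator are forms of one degree [d]; both are divided by the [d]-th power of a
    coordinate that is 1 at [P]. *)
Lemma local_ring_frac P z :
  exists x y : K, [/\ local_ring P x, local_ring P y, y != 0 & z = x / y].
Proof.
have [d [F [G [hF hG G0 ->]]]] := @pv_funP k X z.
have [i Pi _] := normalizedP P.
pose M : {mpoly k[n.+1]} := 'X_i ^+ d.
have hM : M \is d.-homog by rewrite -[d]mul1n; exact/dhomogMn/dhomogXi.
have M0 : pt_eval P M != 0.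
  by rewrite /pt_eval rmorphXn /= mevalXU Pi expr1n oner_neq0.
have M1 := pv_eval_neq0 hM M0.
exists (pv_eval F / pv_eval M), (pv_eval G / pv_eval M); split.
- by exists (pt_eval P F / pt_eval P M), d, F, M.
- by exists (pt_eval P G / pt_eval P M), d, G, M.
- by rewrite mulf_neq0 ?invr_eq0.
- by rewrite invf_div mulrA mulfVK.
Qed.

Definition linform (m : nat) (v : 'rV[k]_m) : {mpoly k[m]} := \sum_i v 0 i *: 'X_i.

Lemma linform_homog m (v : 'rV[k]_m) : linform v \is 1.-homog.
Proof.
by apply: rpred_sum => i _; apply: rpredZ; rewrite dhomogX; apply/eqP; exact: mdeg1.
Qed.

Lemma linform_eval m (v : 'rV[k]_m) x : (linform v).@[x] = \sum_i v 0 i * x i.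
Proof.
by rewrite /linform raddf_sum /=; apply: eq_bigr => i _; rewrite mevalZ mevalXU.
Qed.

(* A row (1, t, t^2, ...) of the moment curve, for t outside the zeros of
   finitely many nonzero polynomials. *)
Lemma avoid_hyperplanes m (L : seq 'rV[k]_m) : all (fun v => v != 0) L ->
  exists v : 'rV[k]_m, all (fun w : 'rV[k]_m => \sum_i v 0 i * w 0 i != 0) L.
Proof.
move=> hL; pose p (w : 'rV[k]_m) := rVpoly w.
have : \prod_(w <- L) p w != 0.
  rewrite prodf_seq_neq0; apply/allP => w /(allP hL) w0 /=.
  by apply: contraNneq w0 => e; rewrite -[w]rVpolyK /= -/(p w) e linear0.
move/closed_nonrootP => [t]; rewrite /root horner_prod prodf_seq_neq0 => ht.
exists (\row_i t ^+ i); apply/allP => w wL.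
have := allP ht w wL; rewrite /= (@horner_coef_wide _ m) ?size_poly //.
congr (_ != _); apply: eq_bigr => i _.
by rewrite mxE coef_rVpoly_ord mulrC.
Qed.

Lemma nonvanishing_form (L : seq (point X)) :
  exists2 G : {mpoly k[n.+1]}, G \is 1.-homog &
    forall P, P \in L -> pt_eval P G != 0.
Proof.
have [|v hv] := @avoid_hyperplanes n.+1 (map (fun P => val P) L).
  apply/allP => _ /mapP[P _ ->]; apply/eqP => e.
  by have [i] := normalizedP P; rewrite e mxE => /esym/eqP; rewrite oner_eq0.
exists (linform v) => [|P PL]; first exact: linform_homog.
by rewrite /pt_eval linform_eval; apply/(allP hv)/map_f.
Qed.

(** [pr] subtracts the multiple of [P] that cancels the [i]-th entry, so it kills only vectors
    proportional to [P]. A linear form that is nonzero on the remaining vectors, composed with [pr],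
    separates. *)
Lemma separating_form P (L : seq (point X)) : P \notin L ->
  exists F : {mpoly k[n.+1]}, [/\ F \is 1.-homog, pt_eval P F = 0 &
    forall P', P' \in L -> pt_eval P' F != 0].
Proof.
move=> PL; have [i Pi _] := normalizedP P.
pose pr (v : 'rV[k]_n.+1) := v - v 0 i *: val P.
have [|v hv] := @avoid_hyperplanes n.+1 (map (fun P' => pr (val P')) L).
  apply/allP => _ /mapP[P' P'L ->]; apply: contraNneq PL => /rowP e.
  suff -> : P = P' by [].
  apply: (@normalized_prop P P' i) => j.
  by move: (e j); rewrite !mxE => /eqP; rewrite subr_eq0 => /eqP.
exists (linform v - (\sum_j v 0 j * val P 0 j) *: 'X_i); split.
- by rewrite rpredB ?linform_homog // rpredZ ?dhomogXi.
- by rewrite /pt_eval mevalB mevalZ mevalXU linform_eval Pi mulr1 subrr.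
move=> P' P'L; have := allP hv _ (map_f _ P'L).
rewrite /pt_eval mevalB mevalZ mevalXU linform_eval mulr_suml -sumrB.
apply: contraNneq => h; apply/eqP; rewrite -[RHS]h; apply: eq_bigr => j _.
by rewrite !mxE mulrBr; congr (_ - _); rewrite -!mulrA [_ * val P' 0 i]mulrC.
Qed.

Lemma separating_function P (L M : seq (point X)) : P \notin L ->
  exists z, [/\ value_at P z 0,
    forall P', P' \in L -> exists2 c, c != 0 & value_at P' z c &
    forall P', P' \in M -> local_ring P' z].
Proof.
move=> /separating_form[F [hF F0 FL]].
have [G hG G0] := nonvanishing_form (P :: L ++ M).
have hv P' : P' \in P :: L ++ M ->
    value_at P' (pv_eval F / pv_eval G) (pt_eval P' F / pt_eval P' G).
  by move=> /G0 ?; exists 1%N, F, G.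
exists (pv_eval F / pv_eval G); split.
- by rewrite -(mul0r (pt_eval P G)^-1) -F0; apply: hv; rewrite mem_head.
- move=> P' P'L; have P'A : P' \in P :: L ++ M by rewrite inE mem_cat P'L orbT.
  exists (pt_eval P' F / pt_eval P' G); last exact: hv.
  by rewrite mulf_neq0 ?invr_eq0 ?FL // G0.
- move=> P' P'M; exists (pt_eval P' F / pt_eval P' G); apply: hv.
  by rewrite inE mem_cat P'M !orbT.
Qed.

(** In this way facts about the comorphism of the involution pass to its action on points. *)
Lemma point_eq P P' : (forall z c, value_at P z c -> value_at P' z c) -> P = P'.
Proof.
move=> h; apply/eqP; apply: contraT => ne.
have [|z [z0 /(_ P' (mem_head _ _))[c c0 zc] _]] :=
  @separating_function P [:: P'] [::]; first by rewrite inE.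
by move: c0; rewrite (value_at_uniq zc (h _ _ z0)) eqxx.
Qed.

End Values.

(** * Local rings of smooth curves *)

Section SmoothCurve.
Variables (k : closedFieldType) (X : proj_variety k).
Local Notation K := (pv_fun X).
Local Notation iota := (pv_const X).
Hypothesis hX : smooth_curve X.
Implicit Types (P : point X) (z w : K).

Lemma value_at_sum0 P (I : eqType) (r : seq I) (f : I -> K) :
  (forall i, i \in r -> value_at P (f i) 0) -> value_at P (\sum_(i <- r) f i) 0.
Proof.
elim: r => [|i r IH] h; first by rewrite big_nil; exact: value_at0.
rewrite big_cons -[X in value_at _ _ X](addr0 0); apply: value_atD.
  by apply: h; rewrite mem_head.
by apply: IH => j jr; apply: h; rewrite inE jr orbT.
Qed.

(* An algebraic relation between t and z has a lexicographically lowest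
   monomial, of which all the others are multiples by elements of the maximal
   ideal if z is infinitely divisible by t. *)
Lemma not_infinitely_divisible P t z : value_at P t 0 -> z != 0 ->
  (forall m, exists2 e, local_ring P e & z = e * t ^+ m) -> False.
Proof.
move=> t0 z0 hz.
have zP : value_at P z 0.
  by have [e he ->] := hz 1%N; apply: value_atM0 => //; rewrite expr1.
have tn0 : t != 0.
  by apply: contraNneq z0 => t00; have [e _ ->] := hz 1%N; rewrite t00 expr1 mulr0.
pose h (i : 'I_2) := if i == 0 then t else z.
have [[_ /(_ h)/existsNP[F /not_implyP[F0 /eqP Fn0]]] _] := hX.
(* Exponents in [F] are below [N], so [key] encodes the lexicographic order with the exponent of [z]
   first. *)
pose N := msize F; pose key (m : 'X_{1..2}) := (m ord_max * N + m 0%R)%N.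
have small m i : m \in msupp F -> (m i < N)%N.
  move=> /msize_mdeg_lt; apply: leq_ltn_trans.
  by rewrite mdegE (bigD1 i) //= leq_addr.
have [m0 m0F m0min] :
    exists2 m0, m0 \in msupp F & forall m, m \in msupp F -> (key m0 <= key m)%N.
  pose Q v := has (fun m => key m == v) (msupp F).
  have exQ : exists v, Q v.
    case e : (msupp F) => [|m s]; first by rewrite -msupp_eq0 e in Fn0.
    by exists (key m); rewrite /Q e /= eqxx.
  case: (ex_minnP exQ) => v /hasP[m0 m0F /eqP e] hv; exists m0 => // m mF.
  by rewrite e; apply: hv; apply/hasP; exists m.
pose mon (m : 'X_{1..2}) := t ^+ m 0 * z ^+ m ord_max.
have mon0 m : mon m != 0 by rewrite mulf_neq0 // expf_neq0.
have r0 m : m \in msupp F -> m != m0 -> value_at P (mon m / mon m0) 0.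
  move=> mF mm0; have le := m0min _ mF.
  have lt0 := small _ 0 m0F; have lt := small _ 0 mF.
  have : (m0 ord_max <= m ord_max)%N.
    rewrite leqNgt; apply/negP => lt1.
    have le' : (m ord_max * N + m 0%R < m0 ord_max * N + m0 0%R)%N.
      apply: leq_trans (leq_addr _ _).
      apply: (@leq_trans ((m ord_max).+1 * N)); last by rewrite leq_mul2r lt1 orbT.
      by rewrite mulSn addnC ltn_add2r.
    by move: le; rewrite /key leqNgt le'.
  rewrite leq_eqVlt => /orP[/eqP e|lt1].
    have lt2 : (m0 0%R < m 0%R)%N.
      rewrite ltn_neqAle; move: le; rewrite /key e leq_add2l => ->; rewrite andbT.
      apply: contraNneq mm0 => e0; apply/eqP/mnmP => i.
      by case: (unliftP 0 i) => [j|] -> //; rewrite (_ : fintype.lift 0 j = ord_max) //;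
        apply/val_inj; case: j => [[]].
    rewrite (_ : mon m / mon m0 = t ^+ (m 0%R - m0 0%R)).
      by rewrite -(subnSK lt2) exprS mulrC; apply: value_atM0 => //;
         apply: local_ringX; exists 0.
    rewrite /mon e -mulf_div divff ?expf_neq0 // mulr1.
    by rewrite expfB.
  (* One factor [z] is traded for a multiple of a power of [t] that exceeds the one in [m0], which
     makes up for a smaller exponent of [t] in [m]. *)
  have [e he ez] := hz (m0 0%R).+1.
  rewrite (_ : mon m / mon m0 =
      z ^+ (m ord_max - (m0 ord_max).+1) * e * t ^+ m 0%R * t).
    apply: value_atM0 => //; apply: local_ringM; last by apply: local_ringX; exists 0.
    by apply: local_ringM => //; apply: local_ringX; exists 0.
  apply: (canLR (mulfK (mon0 _))); rewrite /mon -{1}(subnK lt1) exprD exprS {2}ez exprS.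
  ring.
(* The relation divided by its lowest monomial has the nonzero coefficient at [m0] as its value, yet
   it is zero in [K]. *)
have : value_at P (\sum_(m <- msupp F) iota F@_m * (mon m / mon m0)) F@_m0.
  rewrite (bigD1_seq m0) //= divff // mulr1 -big_filter -[X in value_at _ _ X]addr0.
  apply: value_atD; first exact: value_atC.
  apply: value_at_sum0 => m; rewrite mem_filter => /andP[? ?].
  by apply: value_atM0; [exact: local_ringC|exact: r0].
have -> : \sum_(m <- msupp F) iota F@_m * (mon m / mon m0) = 0.
  apply: (mulIf (mon0 m0)); rewrite mul0r mulr_suml -[RHS]F0 /mmap.
  apply: eq_bigr => m _; rewrite -!mulrA mulVf // mulr1 /mmap1 /mon.
  by rewrite big_ord_recl big_ord1 (_ : fintype.lift ord0 ord0 = ord_max) //; exact: val_inj.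
move/(value_at_uniq (value_at0 P)) => /esym/eqP.
by rewrite mcoeff_eq0 m0F.
Qed.

(** By smoothness one function [t] generates the maximal ideal, and some power of [t] fails to
    divide [z]. Just below the first failure the cofactor has a nonzero value, since otherwise [t]
    could be split off once more. *)
Lemma uniformizer P : exists2 t, value_at P t 0 & forall z, local_ring P z ->
  z != 0 -> exists m u c, [/\ c != 0, value_at P u c & z = u * t ^+ m].
Proof.
have [_ /(_ P)[t [tP tgen]]] := hX; exists (t 0); first exact: tP.
move=> z Pz z0; pose Q m := `[< exists2 e, local_ring P e & z = e * t 0 ^+ m >].
have exQ : exists m, ~~ Q m.
  apply: contrapT => /forallNP h; apply: (not_infinitely_divisible (tP 0) z0) => m.
  by have /negP := h m; rewrite negbK => /asboolP.
case: (ex_minnP exQ) => -[|m] Qm Qmin.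
  by case/asboolP: Qm; exists z => //; rewrite expr0 mulr1.
have /asboolP[e [c ec] ez] : Q m by apply: contraT => /Qmin; rewrite ltnn.
exists m, e, c; split=> //; apply/eqP => c0; case/asboolP: Qm.
rewrite c0 in ec; have [a [ha ea]] := tgen _ ec.
by exists (a 0) => //; rewrite ez ea big_ord1 exprS mulrA.
Qed.

Lemma valuation_ring P z : local_ring P z \/ value_at P z^-1 0.
Proof.
have [t t0 ht] := uniformizer P; have [a [b [Pa Pb b0 ->]]] := local_ring_frac P z.
have [->|a0] := eqVneq a 0; first by left; rewrite mul0r; exact: local_ring0.
have [m [u [c [c0 uc ea]]]] := ht _ Pa a0; have [m' [u' [c' [c'0 uc' eb]]]] := ht _ Pb b0.
have u0 := value_at_neq0 c0 uc; have u'0 := value_at_neq0 c'0 uc'.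
have tm : t ^+ m != 0 by apply: contraNneq a0 => e; rewrite ea e mulr0.
have tm' : t ^+ m' != 0 by apply: contraNneq b0 => e; rewrite eb e mulr0.
case: (leqP m' m) => lemm; [left|right].
  rewrite ea eb -(subnK lemm) exprD mulrA -mulf_div divff // mulr1 mulrAC.
  apply: local_ringM; last by apply: local_ringX; exists 0.
  by exists (c / c'); apply: value_atM => //; exact: value_atV.
rewrite invf_div ea eb -(subnK (ltnW lemm)) exprD mulrA -mulf_div divff // mulr1 mulrAC.
apply: value_atM0; first by exists (c' / c); apply: value_atM => //; exact: value_atV.
rewrite -(subnSK lemm) exprS mulrC; apply: value_atM0 => //.
by apply: local_ringX; exists 0.
Qed.

(** [z] is a multiple of [t], so its [m]-th power cancels the factor [t ^+ m] in the denominator of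
    [w]. *)
Lemma local_ring_archimedean P z w : value_at P z 0 ->
  exists m, local_ring P (z ^+ m * w).
Proof.
have [t t0 ht] := uniformizer P; have [a [b [Pa Pb b0 ->]]] := local_ring_frac P w.
have [m [u [c [c0 uc eb]]]] := ht _ Pb b0 => z0.
have [->|zn0] := eqVneq z 0.
  by exists 1%N; rewrite expr1 mul0r; exact: local_ring0.
have [|[|m'] [u' [c' [c'0 uc' ez]]]] := ht z _ zn0; first by exists 0.
  have u'0 : value_at P u' 0 by rewrite -[u']mulr1 -(expr0 t) -ez.
  by move: c'0; rewrite (value_at_uniq uc' u'0) eqxx.
have tm : t ^+ m != 0 by apply: contraNneq b0 => e; rewrite eb e mulr0.
have u0 := value_at_neq0 c0 uc.
exists m; rewrite (_ : _ * _ = (u' * t ^+ m') ^+ m * (a / u)).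
  apply: local_ringM.
    by apply/local_ringX/local_ringM; [exists c'|apply: local_ringX; exists 0].
  by apply: local_ringM => //; exists c^-1; exact: value_atV.
rewrite ez eb exprS !exprMn; field.
by rewrite u0 tm.
Qed.

(** For use at fixed points of the involution, where [S] consists of the differences of regular
    functions and their conjugates. *)
Lemma minimal_valuation P (S : set K) : (forall z, S z -> local_ring P z) ->
  (exists2 z, S z & z != 0) ->
  exists z, [/\ S z, z != 0 & forall w, S w -> local_ring P (w / z)].
Proof.
have [t t0 ht] := uniformizer P => hS [z0 Sz0 z0n0].
pose Q m := `[< exists z u c,
  [/\ S z, z != 0, c != 0 & value_at P u c /\ z = u * t ^+ m] >].
have exQ : exists m, Q m.
  have [m [u [c [? ? ?]]]] := ht _ (hS _ Sz0) z0n0.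
  by exists m; apply/asboolP; exists z0, u, c.
case: (ex_minnP exQ) => m /asboolP[z [u [c [Sz zn0 c0 [uc ez]]]]] mmin.
exists z; split=> // w Sw; have [->|wn0] := eqVneq w 0.
  by rewrite mul0r; exact: local_ring0.
have [m' [u' [c' [c'0 uc' ew]]]] := ht _ (hS _ Sw) wn0.
have lemm : (m <= m')%N by apply: mmin; apply/asboolP; exists w, u', c'.
have tm : t ^+ m != 0 by apply: contraNneq zn0 => e; rewrite ez e mulr0.
rewrite ez ew -(subnK lemm) exprD mulrA -mulf_div divff // mulr1 mulrAC.
apply: local_ringM; last by apply: local_ringX; exists 0.
by exists (c' / c); apply: value_atM => //; exact: value_atV.
Qed.

End SmoothCurve.

(** * Projective line *)

Section Homogeneous.
Variables (R S : comNzRingType) (n : nat).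

Lemma mmap_scale (f : {rmorphism R -> S}) (h : 'I_n -> S) (a : S) d (G : {mpoly R[n]}) :
  G \is d.-homog -> mmap f (fun i => a * h i) G = a ^+ d * mmap f h G.
Proof.
move=> /dhomogP hG; rewrite /mmap mulr_sumr [LHS]big_seq [RHS]big_seq.
apply: eq_bigr => m /hG <-; rewrite /mmap1 mulrCA; congr (_ * _).
rewrite (eq_bigr (fun i => a ^+ m i * h i ^+ m i)); last by move=> i _; rewrite exprMn.
by rewrite big_split -expr_sum /= -mdegE.
Qed.

Lemma eq_mmap (f : {rmorphism R -> S}) (h h' : 'I_n -> S) (G : {mpoly R[n]}) :
  h =1 h' -> mmap f h G = mmap f h' G.
Proof.
move=> e; rewrite /mmap; apply: eq_bigr => m _; congr (_ * _).
by apply: eq_bigr => i _; rewrite e.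
Qed.

Lemma rmorph_mmap (S' : comNzRingType) (f : {rmorphism R -> S}) (f' : {rmorphism R -> S'})
  (g : {rmorphism S -> S'}) (h : 'I_n -> S) (G : {mpoly R[n]}) :
  (forall c, g (f c) = f' c) -> g (mmap f h G) = mmap f' (fun i => g (h i)) G.
Proof.
move=> gf; rewrite /mmap rmorph_sum; apply: eq_bigr => m _.
rewrite rmorphM gf rmorph_prod; congr (_ * _); apply: eq_bigr => i _.
by rewrite rmorphXn.
Qed.

End Homogeneous.

(** * Polynomials evaluated in a function field *)

Section PolyEval.
Variables (k : closedFieldType) (K : fieldType) (f : {rmorphism k -> K}).

Definition poly_at (u : K) : {poly k} -> K := horner_eval u \o map_poly f.

HB.instance Definition _ (u : K) := GRing.RMorphism.on (poly_at u).

Lemma poly_atC u c : poly_at u c%:P = f c.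
Proof. by rewrite /poly_at /= map_polyC /horner_eval hornerC. Qed.

Lemma poly_atX u : poly_at u 'X = u.
Proof. by rewrite /poly_at /= map_polyX /horner_eval hornerX. Qed.

Lemma poly_at_prod u (s : seq k) :
  poly_at u (\prod_(r <- s) ('X - r%:P)) = \prod_(r <- s) (u - f r).
Proof.
by rewrite rmorph_prod; apply: eq_bigr => r _; rewrite rmorphB /= poly_atC poly_atX.
Qed.

Lemma poly_at_split u p : exists (s : seq k),
  poly_at u p = f (lead_coef p) * \prod_(r <- s) (u - f r).
Proof.
have [s e] := closed_field_poly_normal p; exists s.
by rewrite {1}e -mul_polyC rmorphM /= poly_atC poly_at_prod.
Qed.

(** Over the algebraically closed [k] polynomials split into linear factors, so an element outside
    [k] is transcendental. *)
Lemma poly_at_eq0 u p : (forall r, u != f r) -> poly_at u p = 0 -> p = 0.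
Proof.
move=> hu; have [s ->] := poly_at_split u p => /eqP.
rewrite mulf_eq0 fmorph_eq0 lead_coef_eq0 => /orP[/eqP //|].
by rewrite prodf_seq_eq0 => /hasP[r _ /=]; rewrite subr_eq0 (negPf (hu r)).
Qed.

End PolyEval.

Section PolyValue.
Variables (k : closedFieldType) (X : proj_variety k) (P : point X).

Lemma value_at_poly u (c : k) p : value_at P u c ->
  value_at P (poly_at (pv_const X) u p) p.[c].
Proof.
move=> uc; elim/poly_ind: p => [|p a IH].
  by rewrite rmorph0 horner0; exact: value_at0.
rewrite rmorphD rmorphM /= poly_atX poly_atC hornerMXaddC.
by apply: value_atD; [exact: value_atM|exact: value_atC].
Qed.

Lemma local_ring_poly u p : local_ring P u -> local_ring P (poly_at (pv_const X) u p).
Proof. by move=> [c uc]; exists p.[c]; exact: value_at_poly. Qed.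

End PolyValue.

(** * Points reached by rational curves *)

Section Chart.
Variables (k : closedFieldType) (Y : proj_variety k).
Local Notation cst := (pv_const Y).
Local Notation n := (pv_n Y).
Implicit Types (v : 'rV[k]_n.+1) (u l z : pv_fun Y) (w : 'I_n.+1 -> {poly k}).

(* The curve w passes through the point v at 0 and through the generic point,
   up to the scalar l, at u. *)
Definition chart v u l w :=
  [/\ l != 0, forall r, u != cst r, forall i, pv_gen i = l * poly_at cst u (w i)
    & forall i, v 0 i = (w i).[0]].

Lemma chart_eval v u l w d (G : {mpoly k[n.+1]}) : chart v u l w -> G \is d.-homog ->
  exists2 p : {poly k}, pv_eval G = l ^+ d * poly_at cst u p
    & G.@[fun i => v 0 i] = p.[0].
Proof.
move=> [l0 hu hgen hv] hG; exists (mmap (@polyC k) w G).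
  have -> : poly_at cst u (mmap (@polyC k) w G) = mmap cst (poly_at cst u \o w) G.
    by apply: rmorph_mmap => c; exact: poly_atC.
  by rewrite -(mmap_scale _ _ _ hG); apply: eq_mmap.
have -> : (mmap (@polyC k) w G).[0] = mmap idfun (horner_eval 0 \o w) G.
  by apply: (@rmorph_mmap _ _ _ _ _ _ (horner_eval (0 : k))) => c; exact: hornerC.
by apply: eq_mmap.
Qed.

(** If [G] vanishes at the generic point, its restriction [p] to the curve vanishes at the
    transcendental [u]; so [p] is zero, and so is its value at 0. *)
Lemma chart_on v u l w : chart v u l w -> normalized v -> on_variety v.
Proof.
move=> hc nv; rewrite /on_variety nv; apply/asboolP => d G hG e.
have [p e1 ->] := chart_eval hc hG; have [l0 hu _ _] := hc.
move/eqP: e; rewrite e1 mulf_eq0 expf_eq0 (negPf l0) andbF /= => /eqP.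
by move/(poly_at_eq0 hu) => ->; rewrite horner0.
Qed.

Lemma chart_value Q u l w z c : chart (val Q) u l w -> value_at Q z c ->
  exists p q : {poly k}, [/\ q.[0] != 0, z = poly_at cst u p / poly_at cst u q
    & c = p.[0] / q.[0]].
Proof.
move=> hc [d [A [B [hA hB]]]]; rewrite /pt_eval.
have [p -> ->] := chart_eval hc hA; have [q -> ->] := chart_eval hc hB.
move=> q0 -> ->; exists p, q; split=> //; have [l0 _ _ _] := hc.
by rewrite -mulf_div divff ?mul1r // expf_neq0.
Qed.

End Chart.

(** The study of double covers sees the line only through this interface. By [pl_valueP] a regular
    function is a quotient of polynomials in the local parameter, evaluated by setting the parameter
    to 0. *)
Record projective_line (k : closedFieldType) (Y : proj_variety k) := ProjectiveLine {
  pl_T : pv_fun Y;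
  pl_inf : point Y;
  pl_pt : k -> point Y;
  pl_param : point Y -> pv_fun Y;
  pl_param_inf : pl_param pl_inf = pl_T^-1;
  pl_param_pt : forall a, pl_param (pl_pt a) = pl_T - pv_const Y a;
  pl_pointP : forall Q, Q = pl_inf \/ exists a, Q = pl_pt a;
  pl_pt_neq_inf : forall a, pl_pt a != pl_inf;
  pl_param_nonconst : forall Q r, pl_param Q != pv_const Y r;
  pl_param_value : forall Q, value_at Q (pl_param Q) 0;
  pl_valueP : forall Q z c, value_at Q z c -> exists p q : {poly k},
    [/\ q.[0] != 0,
      z = poly_at (pv_const Y) (pl_param Q) p / poly_at (pv_const Y) (pl_param Q) q
      & c = p.[0] / q.[0]]
}.

(** * Principal parts, Mittag-Leffler and vanishing of regular differentials on the line *)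

Section ProjectiveLine.
Variables (k : closedFieldType) (Y : proj_variety k) (L : projective_line Y).
Local Notation cst := (pv_const Y).
Local Notation T := (pl_T L).
Implicit Types (Q : point Y) (z : pv_fun Y) (a : k).

Lemma pl_param_neq0 Q : pl_param L Q != 0.
Proof. by rewrite -(rmorph0 cst); exact: pl_param_nonconst. Qed.

Lemma pl_T_neq0 : T != 0.
Proof. by rewrite -invr_eq0 -pl_param_inf pl_param_neq0. Qed.

Lemma pl_T_nonconst a : T != cst a.
Proof. by rewrite -subr_eq0 -pl_param_pt pl_param_neq0. Qed.

(** The inverse parameter has its only pole at [Q], so its powers serve as principal parts. *)
Lemma pl_param_inv Q Q' : Q' != Q -> local_ring Q' (pl_param L Q)^-1.
Proof.
have [->|[a ->]] := (pl_pointP L) Q => ne.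
  rewrite (pl_param_inf L) invrK; have [e|[b ->]] := (pl_pointP L) Q'.
    by rewrite e eqxx in ne.
  have [c hc] : local_ring (pl_pt L b) (pl_param L (pl_pt L b)).
    by exists 0; exact: (pl_param_value L).
  rewrite (pl_param_pt L) in hc; exists (c + b); rewrite -[T](subrK (cst b)).
  by apply: value_atD => //; exact: value_atC.
have [->|[b eb]] := (pl_pointP L) Q'.
  have h := (pl_param_value L) (pl_inf L); rewrite (pl_param_inf L) in h.
  exists (0 / (1 - a * 0)); rewrite (pl_param_pt L).
  rewrite (_ : _^-1 = T^-1 / (1 - cst a * T^-1)); last first.
    have h0 := pl_T_neq0; have h1 := pl_T_nonconst a; rewrite -subr_eq0 in h1.
    rewrite -invfM mulrBr mulr1 mulrCA divff // mulr1 //.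
  apply: value_atM => //; apply: value_atV; first by rewrite mulr0 subr0 oner_neq0.
  by apply: value_atB; [exact: value_at1|apply: value_atM => //; exact: value_atC].
have h := (pl_param_value L) (pl_pt L b); rewrite eb !(pl_param_pt L) in h *.
exists (0 + (b - a))^-1; apply: value_atV.
  rewrite add0r subr_eq0; by apply: contraNneq ne => e; rewrite eb e eqxx.
rewrite (_ : T - cst a = T - cst b + cst (b - a)).
  by apply: value_atD => //; exact: value_atC.
by rewrite rmorphB addrA subrK.
Qed.

Lemma pl_max_ideal Q z : value_at Q z 0 -> exists2 w, local_ring Q w & z = pl_param L Q * w.
Proof.
move=> /(pl_valueP L)[p [q [q0 ez /esym/eqP]]].
rewrite mulf_eq0 invr_eq0 (negPf q0) orbF => /factor_theorem[p' ep].
have u0 := (pl_param_value L) Q.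
exists (poly_at cst (pl_param L Q) p' / poly_at cst (pl_param L Q) q).
  apply: local_ringM; first by apply: local_ring_poly; exists 0.
  by exists q.[0]^-1; apply: value_atV => //; exact: value_at_poly.
by rewrite ez ep subr0 rmorphM /= poly_atX mulrA [_ * pl_param L Q]mulrC.
Qed.

Lemma pl_pole Q z : exists m, local_ring Q (pl_param L Q ^+ m * z).
Proof.
have [a [b [Qa [c /(pl_valueP L)[p [q [q0 eb ec]]]] b0 ->]]] := local_ring_frac Q z.
have p0 : p != 0 by apply: contraNneq b0 => p0; rewrite eb p0 rmorph0 mul0r.
have [m [p' /implyP/(_ p0) p'0 ep]] := multiplicity_XsubC p 0.
have u0 := (pl_param_value L) Q; have un0 := pl_param_neq0 Q.
rewrite subr0 in ep; exists m.
have h : local_ring Q (a * poly_at cst (pl_param L Q) q / poly_at cst (pl_param L Q) p').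
  apply: local_ringM; first by apply: local_ringM => //; apply: local_ring_poly; exists 0.
  by exists p'.[0]^-1; apply: value_atV => //; exact: value_at_poly.
rewrite (_ : _ * _ = a * poly_at cst (pl_param L Q) q / poly_at cst (pl_param L Q) p') //.
rewrite eb ep rmorphM rmorphXn /= poly_atX; field.
have -> : poly_at cst (pl_param L Q) p' != 0.
  by apply: (@value_at_neq0 _ _ Q _ p'.[0]) => //; exact: value_at_poly.
have -> : poly_at cst (pl_param L Q) q != 0.
  by apply: (@value_at_neq0 _ _ Q _ q.[0]) => //; exact: value_at_poly.
by rewrite expf_neq0.
Qed.

(** Induction on a bound for the pole of [z]: if the cleared function has value 0, one factor of the
    parameter cancels; otherwise it is a unit and [z^-1] is a multiple of the parameter. *)
Lemma pl_valuation_ring Q z : local_ring Q z \/ value_at Q z^-1 0.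
Proof.
have [m hm] := pl_pole Q z; elim: m hm => [|m IH hm]; first by rewrite mul1r; left.
have [c hc] := hm; have un0 := pl_param_neq0 Q.
have [c0|c0] := eqVneq c 0.
  rewrite c0 in hc; have [w hw /eqP] := pl_max_ideal hc.
  by rewrite exprS -mulrA (inj_eq (mulfI un0)) => /eqP e; apply: IH; rewrite e.
right; rewrite (_ : z^-1 = (pl_param L Q ^+ m.+1 * z)^-1 * pl_param L Q ^+ m * pl_param L Q).
  apply: value_atM0; last exact: (pl_param_value L).
  apply: local_ringM; first by exists c^-1; exact: value_atV.
  by apply: local_ringX; exists 0; exact: (pl_param_value L).
by rewrite -mulrA -exprSr invfM mulrAC mulVf ?mul1r // expf_neq0.
Qed.

(** Subtracting the leading term, with coefficient the value [c] of the cleared function, lowers the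
    order of the pole. *)
Lemma pl_principal_part Q z : exists h, local_ring Q (z - h) /\
  forall Q', Q' != Q -> local_ring Q' h.
Proof.
have [m] := pl_pole Q z; have un0 := pl_param_neq0 Q.
elim: m z => [|m IH] z hm.
  exists 0; rewrite subr0 -[z]mul1r; split=> // Q' _; exact: local_ring0.
have [c hc] := hm.
have [|w hw ew] := @pl_max_ideal Q (pl_param L Q ^+ m.+1 * z - cst c).
  by rewrite -(subrr c); apply: value_atB => //; exact: value_atC.
have [|h [h1 h2]] := IH (z - cst c * (pl_param L Q)^-1 ^+ m.+1).
  rewrite (_ : _ * _ = w) //; apply: (mulfI un0); rewrite mulrA -exprS -ew mulrBr.
  by rewrite mulrCA exprVn mulfV ?mulr1 // expf_neq0.
exists (cst c * (pl_param L Q)^-1 ^+ m.+1 + h); split; first by rewrite opprD addrA.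
move=> Q' ne; apply: local_ringD; last exact: h2.
by apply: local_ringM; [exact: local_ringC|exact/local_ringX/pl_param_inv].
Qed.

(** Removing the principal part at one bad point creates no pole elsewhere, so the points of [S] can
    be treated one after another. *)
Lemma pl_cousin (t : point Y -> pv_fun Y) (S : seq (point Y)) :
  (forall Q, Q \notin S -> local_ring Q (t Q)) -> exists h, forall Q, local_ring Q (t Q - h).
Proof.
elim: S t => [|Q0 S IH] t ht; first by exists 0 => Q; rewrite subr0; exact: ht.
have [h0 [h1 h2]] := pl_principal_part Q0 (t Q0).
have [Q QS|h hh] := IH (fun Q => t Q - h0).
  have [->//|ne] := eqVneq Q Q0.
  by apply: local_ringB; [apply: ht; rewrite inE (negPf ne)|exact: h2].
by exists (h0 + h) => Q; rewrite opprD addrA.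
Qed.

Lemma pl_frac z : exists p q : {poly k}, q != 0 /\ z = poly_at cst T p / poly_at cst T q.
Proof.
have eT : pl_param L (pl_pt L 0) = T by rewrite (pl_param_pt L) rmorph0 subr0.
have [a [b [[c hc] [c' hc'] b0 ->]]] := local_ring_frac (pl_pt L 0) z.
have [p [q [q0 ea _]]] := pl_valueP L hc; have [p' [q' [q'0 eb _]]] := pl_valueP L hc'.
rewrite {}ea {}eb in b0 *.
rewrite eT in b0 *; exists (p * q'), (q * p'); split.
  rewrite mulf_neq0 //; first by apply: contraNneq q0 => ->; rewrite horner0.
  by apply: contraNneq b0 => ->; rewrite rmorph0 mul0r.
by rewrite !rmorphM /= invf_div mulf_div.
Qed.

Lemma pl_finite_poles z : exists S : seq (point Y), forall Q, Q \notin S -> local_ring Q z.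
Proof.
have [p [q [q0 ->]]] := pl_frac z; have [s eq] := poly_at_split cst T q.
exists ((pl_inf L) :: map (pl_pt L) s) => Q; rewrite inE negb_or => /andP[Qinf Qs].
have QT : local_ring Q T by rewrite -[T]invrK -(pl_param_inf L); exact: pl_param_inv.
rewrite eq invfM -prodfV mulrCA mulrC; apply: local_ringM; last first.
  by rewrite -fmorphV; exact: local_ringC.
apply: local_ringM; first exact: local_ring_poly.
elim: s Qs {eq} => [|r s IH]; first by rewrite big_nil => _; exact: local_ring1.
rewrite inE negb_or big_cons => /andP[Qr Qs]; apply: local_ringM; last exact: IH.
by rewrite -(pl_param_pt L); exact: pl_param_inv.
Qed.

(** The linear factors of the denominator are cancelled one at a time: regularity at a root [r]
    forces the numerator to vanish there. *)
Lemma pl_polynomial z : (forall a, local_ring (pl_pt L a) z) -> exists p, z = poly_at cst T p.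
Proof.
have [p [q [q0 ->]]] := pl_frac z; have [s ->] := poly_at_split cst T q.
rewrite invfM mulrA -fmorphV -(poly_atC cst T) -rmorphM /=.
move: (p * _) => {q q0}p; elim: s p => [|r s IH] p hz.
  by exists p; rewrite big_nil invr1 mulr1.
move: hz; rewrite big_cons.
have rn0 : T - cst r != 0 by rewrite subr_eq0; exact: pl_T_nonconst.
set y := (_ / _) => hy.
have ey : poly_at cst T p / \prod_(r <- s) (T - cst r) = y * (T - cst r).
  by rewrite /y invfM [RHS]mulrC mulrCA mulVKf.
have hT a b : value_at (pl_pt L a) (T - cst b) (a - b).
  rewrite (_ : T - cst b = pl_param L (pl_pt L a) + cst (a - b)).
    rewrite -[X in value_at _ _ X]add0r; apply: value_atD; last exact: value_atC.
    exact: (pl_param_value L).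
  by rewrite (pl_param_pt L) rmorphB addrA subrK.
have [|p' ep'] := IH p.
  by move=> a; rewrite ey; apply: local_ringM => //; exists (a - r).
have /factor_theorem[p'' ep''] : root p' r.
  apply/eqP/(@value_at_uniq _ _ (pl_pt L r) (y * (T - cst r))).
    rewrite -ey ep'; apply: value_at_poly.
    by have := hT r 0; rewrite rmorph0 !subr0.
  by apply: value_atM0 => //; have := hT r r; rewrite subrr.
exists p''; apply: (mulIf rn0); rewrite -ey ep' ep'' rmorphM rmorphB /=.
by rewrite poly_atX poly_atC.
Qed.

(** With [z] the coefficient of dT, the second hypothesis is regularity at infinity, as dT = -T^2
    d(T^-1). A nonzero polynomial in [T] has an inverse regular at infinity, so 1 would be a
    multiple of [T^-1] there. *)
Lemma pl_no_differential z : (forall a, local_ring (pl_pt L a) z) ->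
  local_ring (pl_inf L) (T ^+ 2 * z) -> z = 0.
Proof.
move=> /pl_polynomial[p ->] h; have [->|p0] := eqVneq p 0; first by rewrite rmorph0.
have q0 : poly_at cst T p != 0.
  by apply: contraNneq p0 => /poly_at_eq0 -> // r; exact: pl_T_nonconst.
have hp : local_ring (pl_inf L) (poly_at cst T p)^-1.
  have [s ->] := poly_at_split cst T p; rewrite invfM -fmorphV.
  apply: local_ringM; first exact: local_ringC.
  rewrite -prodfV; elim: s => [|r s IH]; first by rewrite big_nil; exact: local_ring1.
  rewrite big_cons -(pl_param_pt L); apply: local_ringM => //; apply: pl_param_inv.
  by rewrite eq_sym; exact: pl_pt_neq_inf.
have := (pl_param_value L) (pl_inf L); rewrite (pl_param_inf L) => hT.
have : value_at (pl_inf L) 1 0.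
  rewrite (_ : 1 = T ^+ 2 * poly_at cst T p * (poly_at cst T p)^-1 * T^-1 * T^-1).
    apply: value_atM0 => //; apply: local_ringM; last by exists 0.
    exact: local_ringM.
  by rewrite mulfK // -mulrA -invfM -expr2 divff // expf_neq0 // pl_T_neq0.
by move=> /(value_at_uniq (value_at1 _))/eqP; rewrite oner_eq0.
Qed.

End ProjectiveLine.

(** * Points and parameters of the coordinate line *)

Section P1.
Variable k : closedFieldType.
Local Notation F := {fraction {poly k}}.
Local Notation cst := (pv_const (P1 k)).
Local Notation T := (FracField.tofrac ('X : {poly k}) : pv_fun (P1 k)).
Implicit Types (Q : point (P1 k)) (z : pv_fun (P1 k)) (a : k).

Lemma P1_nonconst a : T != cst a.
Proof.
apply/eqP => e; have : FracField.tofrac ('X - a%:P : {poly k}) == 0.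
  by rewrite rmorphB subr_eq0; apply/eqP.
by rewrite tofrac_eq0 polyXsubC_eq0.
Qed.

Lemma P1_T_neq0 : T != 0.
Proof. by rewrite -(rmorph0 cst); exact: P1_nonconst. Qed.

Let v_inf : 'rV[k]_2 := \row_i (i == 1)%:R.
Let v_pt a : 'rV[k]_2 := \row_i (if i == 0 then 1 else a).

Let norm_inf : normalized (X := P1 k) v_inf.
Proof.
apply/existsP; exists ord_max; rewrite mxE; apply/andP; split; first exact: eqxx.
apply/forallP => j; apply/implyP => j1; rewrite mxE.
by case: (j =P 1) => [e|_ //=]; move: j1; rewrite e ltnn.
Qed.

Let norm_pt a : normalized (X := P1 k) (v_pt a).
Proof.
apply/existsP; exists ord0; rewrite mxE; apply/andP; split; first exact: eqxx.
by apply/forallP => j; rewrite ltn0.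
Qed.

Let ord2P (i : 'I_2) : i = 0 \/ i = 1.
Proof. by case: i => [[|[|//]] hi]; [left|right]; apply/val_inj. Qed.

(** The generic point (1 : T) is T times (T^-1 : 1), so the curve [('X : 1)] passes through it at
    [T^-1] and through infinity at 0. *)
Let chart_inf : chart (Y := P1 k) v_inf T^-1 T (fun i => if i == 0 then 'X else 1).
Proof.
split.
- exact: P1_T_neq0.
- move=> r; apply: contraNneq (P1_nonconst r^-1) => e.
  by rewrite fmorphV -e invrK.
- move=> i; rewrite /= /P1_gen; case: (ord2P i) => -> /=.
    by rewrite poly_atX expr0 rmorph1 divff // P1_T_neq0.
  by rewrite rmorph1 mulr1 expr1.
- by move=> i; rewrite mxE; case: (ord2P i) => -> /=; rewrite ?hornerX ?hornerC.
Qed.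

Let chart_pt a : chart (Y := P1 k) (v_pt a) (T - cst a) 1
  (fun i => if i == 0 then 1 else 'X + a%:P).
Proof.
split.
- exact: oner_neq0.
- move=> r; apply: contraNneq (P1_nonconst (r + a)) => e.
  by rewrite rmorphD -e subrK.
- move=> i; rewrite /= /P1_gen mul1r; case: (ord2P i) => -> /=.
    by rewrite expr0 !rmorph1.
  by rewrite rmorphD /= poly_atX poly_atC subrK.
- move=> i; rewrite mxE.
  by case: (ord2P i) => -> /=; rewrite ?hornerD ?hornerX ?hornerC ?add0r.
Qed.

Definition P1_inf : point (P1 k) := exist _ v_inf (chart_on chart_inf norm_inf).
Definition P1_pt a : point (P1 k) := exist _ (v_pt a) (chart_on (chart_pt a) (norm_pt a)).

Lemma P1_pointP Q : Q = P1_inf \/ exists a, Q = P1_pt a.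
Proof.
have [i e h] := normalizedP Q; case: (ord2P i) => ei; rewrite {}ei in e h.
  right; exists (val Q 0 1); apply/val_inj/rowP => j; rewrite mxE.
  by case: (ord2P j) => ->.
left; apply/val_inj/rowP => j; rewrite mxE.
by case: (ord2P j) => ->; [rewrite h|rewrite e].
Qed.

Definition P1_param Q : pv_fun (P1 k) :=
  if Q == P1_inf then T^-1 else T - cst (val Q 0 1).

Lemma P1_param_inf : P1_param P1_inf = T^-1.
Proof. by rewrite /P1_param eqxx. Qed.

Lemma P1_param_pt a : P1_param (P1_pt a) = T - cst a.
Proof.
rewrite /P1_param ifF ?mxE //; apply/eqP => /(congr1 val) /rowP /(_ 0).
by rewrite !mxE /= => /eqP; rewrite oner_eq0.
Qed.

Let charted Q : exists l w, chart (val Q) (P1_param Q) l w.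
Proof.
have [->|[a ->]] := P1_pointP Q.
  by rewrite P1_param_inf; do 2 eexists; exact: chart_inf.
by rewrite P1_param_pt; do 2 eexists; exact: chart_pt.
Qed.

Lemma P1_valueP Q z c : value_at Q z c ->
  exists p q : {poly k}, [/\ q.[0] != 0,
    z = poly_at cst (P1_param Q) p / poly_at cst (P1_param Q) q & c = p.[0] / q.[0]].
Proof. by have [l [w hc]] := charted Q; exact: (chart_value hc). Qed.

Lemma P1_param_nonconst Q r : P1_param Q != cst r.
Proof. by have [l [w [_ h _ _]]] := charted Q. Qed.

Lemma P1_pt_neq_inf a : P1_pt a != P1_inf.
Proof.
apply/eqP => /(congr1 val) /rowP /(_ 0).
by rewrite !mxE /= => /eqP; rewrite oner_eq0.
Qed.

Let evX (i : 'I_2) : pv_eval (X := P1 k) 'X_i = P1_gen k i.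
Proof. by rewrite /pv_eval mmapX mmap1U. Qed.

Lemma P1_param_value Q : value_at Q (P1_param Q) 0.
Proof.
have [->|[a ->]] := P1_pointP Q.
  rewrite P1_param_inf; exists 1%N, 'X_0, 'X_1; split.
  - exact: (@dhomogXi k (P1 k)).
  - exact: (@dhomogXi k (P1 k)).
  - by rewrite /pt_eval mevalXU mxE oner_neq0.
  - by rewrite !evX /P1_gen expr0 rmorph1 div1r.
  - by rewrite /pt_eval !mevalXU !mxE /= mul0r.
rewrite P1_param_pt; exists 1%N, ('X_1 - a *: 'X_0), 'X_0; split.
- by rewrite rpredB ?rpredZ //; exact: (@dhomogXi k (P1 k)).
- exact: (@dhomogXi k (P1 k)).
- by rewrite /pt_eval mevalXU mxE oner_neq0.
- rewrite evX /pv_eval mmapB mmapZ -!/(pv_eval _) !evX /P1_gen expr0 rmorph1.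
  by rewrite divr1 mulr1 expr1.
- by rewrite /pt_eval mevalB mevalZ !mevalXU !mxE /= mulr1 subrr mul0r.
Qed.

Definition P1_line : projective_line (P1 k) := ProjectiveLine P1_param_inf P1_param_pt
  P1_pointP P1_pt_neq_inf P1_param_nonconst P1_param_value P1_valueP.

End P1.

(** * Differentials and genus *)

Section Forms.
Variables (k K : fieldType) (iota : {rmorphism k -> K}).

Lemma kaehler_span (t : K) : (forall z, exists a, kd iota z = a *: kd iota t) ->
  forall w : kaehler iota, exists a, w = a *: kd iota t.
Proof.
move=> h w; rewrite -[w]lquot_piK; move: (repr w) => u.
rewrite -[u]freeg_sumE raddf_sum; elim/big_rec: _ => [|x v _ [a ->]].
  by exists 0; rewrite scale0r.
have [b eb] := h x; exists (coeff x u * b + a).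
rewrite scalerDl -scalerA -eb; congr (_ + _).
by rewrite /kd -linearZ freegUZ mulr1.
Qed.

Lemma kdV z : z != 0 -> kd iota z^-1 = - (z^-1 ^+ 2) *: kd iota z.
Proof.
move=> z0; have : kd iota (z * z^-1) = 0 by rewrite divff // -(rmorph1 iota) kdC.
rewrite kdM => /eqP; rewrite addr_eq0 => /eqP /(congr1 (fun w => z^-1 *: w)).
by rewrite scalerA mulVf // scale1r scalerN scalerA -expr2 scaleNr.
Qed.

End Forms.

Section FormsOnCurve.
Variables (k : closedFieldType) (X : proj_variety k).
Local Notation K := (pv_fun X).
Local Notation iota := (pv_const X).

Implicit Types (P : point X) (z : K) (w : kaehler iota).

Lemma kd_poly u p : kd iota (poly_at iota u p) = poly_at iota u p^`() *: kd iota u.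
Proof.
elim/poly_ind: p => [|p c IH].
  by rewrite deriv0 !rmorph0 -(rmorph0 iota) kdC rmorph0 scale0r.
rewrite derivD derivC addr0 derivM derivX mulr1 !rmorphD !rmorphM /= poly_atC poly_atX.
by rewrite kdD kdC addr0 kdM IH scalerA addrC scalerDl mulrC.
Qed.

Lemma dregularM P z w : local_ring P z -> dregular P w -> dregular P (z *: w).
Proof.
move=> hz [m [a [b [hab ->]]]]; exists m, (fun i => z * a i), b; split.
  by move=> i; have [? ?] := hab i; split=> //; exact: local_ringM.
by rewrite scaler_sumr; apply: eq_bigr => i _; rewrite scalerA.
Qed.

Lemma dregular_kd P z : local_ring P z -> dregular P (kd iota z).
Proof.
move=> hz; exists 1%N, (fun=> 1), (fun=> z); split; last by rewrite big_ord1 scale1r.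
by split=> //; exact: local_ring1.
Qed.

Lemma dregular0 P : dregular P (0 : kaehler iota).
Proof. by exists 0%N, (fun=> 0), (fun=> 0); split; [case|rewrite big_ord0]. Qed.

Lemma genus_form_neq0 g : has_genus X g -> (0 < g)%N ->
  exists2 w : kaehler iota, w != 0 & forall P, dregular P w.
Proof.
case: g => // g [w [wreg wuniq]] _; exists (w 0) => //; apply/eqP => w0.
have [c [_ cu]] := wuniq 0 dregular0.
(* Were [w 0] zero, its coefficient in a representation of 0 would be arbitrary. *)
have h (x : k) : c = [ffun i => if i == 0 then x else 0].
  apply: cu; rewrite big1 // => i _; rewrite ffunE.
  by case: eqP => [->|_]; rewrite ?w0 ?scaler0 // rmorph0 scale0r.
have /ffunP/(_ 0) := etrans (esym (h 0)) (h 1).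
by rewrite !ffunE eqxx => /eqP; rewrite eq_sym oner_eq0.
Qed.

(* If f were not constant, the forms f^i w would be linearly independent. *)
Lemma genus_regular_const g z (w : kaehler iota) : has_genus X g ->
  (forall P, local_ring P z) -> (forall P, dregular P w) -> w != 0 ->
  exists c, z = iota c.
Proof.
move=> [e [ereg espan]] hz hw w0.
have hc (n : 'I_g.+1) : exists c : {ffun 'I_g -> k}, z ^+ n *: w = \sum_i iota (c i) *: e i.
  have [|c [ec _]] := espan (z ^+ n *: w); last by exists c.
  by move=> P; apply: dregularM => //; exact: local_ringX.
(* [A] has more rows than columns. A nonzero row in its left kernel is read as a polynomial whose
   value at [z] annihilates [w]. *)
have [c ec] := choice hc; pose A := \matrix_(n < g.+1, i < g) c n i.
have : kermx A != 0.
  by rewrite kermx_eq0 /row_free neq_ltn ltnS rank_leq_col.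
case/rowV0Pn => v /sub_kermxP vA v0.
have vc i : \sum_n v 0 n * c n i = 0.
  have := congr1 (fun B : 'rV_g => B 0 i) vA; rewrite !mxE; apply: etrans.
  by apply: eq_bigr => n _; rewrite mxE.
apply: contrapT => /forallNP nc; case/eqP: v0; rewrite -[v]rVpolyK.
rewrite (_ : rVpoly v = 0) ?linear0 //; apply: (@poly_at_eq0 _ _ iota z).
  by move=> r; apply/eqP; exact: nc.
have : poly_at iota z (rVpoly v) *: w = 0.
  rewrite /poly_at /= /horner_eval (@horner_coef_wide _ g.+1); last first.
    by rewrite size_map_poly size_poly.
  rewrite scaler_suml (eq_bigr (fun n : 'I_g.+1 => \sum_i iota (v 0 n * c n i) *: e i)).
    rewrite exchange_big big1 // => i _.
    by rewrite -scaler_suml -rmorph_sum vc rmorph0 scale0r.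
  move=> n _; rewrite coef_map coef_rVpoly_ord -scalerA ec scaler_sumr.
  by apply: eq_bigr => i _; rewrite scalerA -rmorphM.
by move/eqP; rewrite scaler_eq0 (negPf w0) orbF => /eqP.
Qed.

End FormsOnCurve.

(** * Double covers of the line *)

Section DoubleCover.
Variables (k : closedFieldType) (X Y : proj_variety k) (L : projective_line Y).
Variables (pi : dominant_morphism X Y) (sigma : dominant_morphism X X).
Hypotheses (hX : smooth_curve X) (hdeg : has_degree pi 2).
Hypotheses (hsig : ~ dm_eq sigma (dm_id X)) (hpis : dm_eq (dm_comp pi sigma) pi).
Local Notation K := (pv_fun X).
Local Notation j := (dm_fun pi).
Local Notation s := (dm_fun sigma).
Implicit Types (P : point X) (z y : K) (f : pv_fun Y).

Lemma inv_pull f : s (j f) = j f.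
Proof. exact: hpis.2. Qed.

Lemma cover_inv P : pi (sigma P) = pi P.
Proof. exact: hpis.1. Qed.

Lemma inv_nontrivial : exists y, s y != y.
Proof.
apply: contrapT => /forallNP h; have sid z : s z = z.
  by apply/eqP; have /negP := h z; rewrite negbK.
apply: hsig; split=> // P; apply: point_eq => z c /dm_reg.
by rewrite sid.
Qed.

(** [s] fixes the image of [j] but not [y], so 1 and [y] are independent over that image. [D] is the
    determinant of their coordinates, and the coefficients come from Cramer's rule. *)
Lemma quadratic_basis y z : s y != y -> exists f0 f1, z = j f0 + j f1 * y.
Proof.
move=> sy; have [e he] := hdeg; have span x : exists c0 c1, x = j c0 * e 0 + j c1 * e 1.
  have [c [-> _]] := he x; exists (c 0), (c 1).
  by rewrite big_ord_recl big_ord1; congr (_ + j (c _) * e _); exact: val_inj.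
have [c0 [c1 e1]] := span 1; have [d0 [d1 ey]] := span y; have [b0 [b1 ez]] := span z.
pose D := c0 * d1 - c1 * d0.
have [D0|D0] := eqVneq D 0.
  have h (a0 b : pv_fun Y) : a0 != 0 -> j a0 * y = j b -> False.
    move=> a00 e2; move/eqP: sy; apply.
    have -> : y = j (b / a0); last exact: inv_pull.
    by rewrite rmorphM fmorphV -e2 mulrC mulKf // fmorph_eq0.
  have eD : j c0 * j d1 = j c1 * j d0.
    by rewrite -!rmorphM; congr (j _); apply/eqP; rewrite -subr_eq0; apply/eqP.
  have [c00|/h ne] := eqVneq c0 0; last first.
    exfalso; apply: (ne d0); rewrite -[RHS]mulr1 e1 ey mulrDr [_ * (j d1 * _)]mulrA eD; ring.
  have [c10|/h ne] := eqVneq c1 0.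
    by move/eqP: e1; rewrite c00 c10 rmorph0 !mul0r addr0 oner_eq0.
  exfalso; apply: (ne d1); rewrite -[RHS]mulr1 e1 ey mulrDr [_ * (j d0 * _)]mulrA -eD; ring.
have jD : j D != 0 by rewrite fmorph_eq0.
exists ((b0 * d1 - b1 * d0) / D), ((b1 * c0 - b0 * c1) / D).
rewrite !rmorphM !fmorphV; apply: (mulIf jD).
rewrite mulrDl mulfVK // [_ * y * _]mulrAC mulfVK //.
rewrite ez ey -[j (b0 * d1 - _)]mulr1 e1 /D !rmorphB !rmorphM; ring.
Qed.

(** Applying [s] to the quadratic equation of [y] and subtracting gives
    [(y + s y) * (y - s y) = j f1 * (y - s y)], so the linear coefficient is the trace. *)
Lemma inv_basis : exists y f,
  [/\ s y != y, j f = y + s y & forall z, exists f0 f1, z = j f0 + j f1 * y].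
Proof.
have [y sy] := inv_nontrivial; have [f0 [f1 e]] := quadratic_basis (y * y) sy.
exists y, f1; split=> //; last by move=> z; exact: quadratic_basis.
have ne : y - s y != 0 by rewrite subr_eq0 eq_sym.
apply: (mulIf ne); have := congr1 s e; rewrite rmorphM rmorphD rmorphM !inv_pull => e'.
have : y * y - s y * s y = j f0 + j f1 * y - (j f0 + j f1 * s y) by rewrite -e -e'.
move=> e''; have -> : (y + s y) * (y - s y) = y * y - s y * s y by ring.
rewrite e''; ring.
Qed.

(** [s] fixes the trace [y + s y], which forces [s (s y) = y]. *)
Lemma inv_invol z : s (s z) = z.
Proof.
have [y [f [_ ef hy]]] := inv_basis; have [f0 [f1 ->]] := hy z.
suff e : s (s y) = y by rewrite !(rmorphD, rmorphM) /= !inv_pull e.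
have := congr1 s ef; rewrite inv_pull rmorphD ef [y + _]addrC => /addrI //.
Qed.

Lemma trace_pull z : exists f, j f = z + s z.
Proof.
have [y [f [_ ef hy]]] := inv_basis; have [f0 [f1 ->]] := hy z.
exists (f0 *+ 2 + f1 * f); rewrite !(rmorphD, rmorphM, rmorphMn) !inv_pull ef; ring.
Qed.

(** [y * s y] is fixed by [s], and a fixed element has no component along [y]. *)
Lemma norm_pull z : exists f, j f = z * s z.
Proof.
have [y [f [sy ef hy]]] := inv_basis; have [g0 [g1 eg]] := hy (y * s y).
have g10 : j g1 = 0.
  have := congr1 s eg; rewrite rmorphM inv_invol mulrC eg rmorphD rmorphM !inv_pull.
  move/addrI/eqP; rewrite eq_sym -subr_eq0 -mulrBr mulf_eq0 subr_eq0.
  by rewrite (negPf sy) orbF => /eqP.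
have [f0 [f1 ->]] := hy z; exists (f0 ^+ 2 + f0 * f1 * f + f1 ^+ 2 * g0).
have eg' : y * s y = j g0 by rewrite eg g10 mul0r addr0.
rewrite !(rmorphD, rmorphM, rmorphXn) /= !inv_pull ef -eg'; ring.
Qed.

Lemma inv_pt_invol P : sigma (sigma P) = P.
Proof. by apply: point_eq => z c /dm_reg/dm_reg; rewrite inv_invol. Qed.

Lemma value_inv P z c : value_at P z c -> value_at (sigma P) (s z) c.
Proof. by move=> h; apply: dm_reg; rewrite inv_pt_invol. Qed.

Lemma local_ring_inv P z : local_ring P z -> local_ring (sigma P) (s z).
Proof. by move=> [c h]; exists c; exact: value_inv. Qed.

(** Otherwise the inverse of [f] would vanish at [pi P], and 1 would have value 0 at [P]. *)
Lemma local_ring_descend P f : local_ring P (j f) -> local_ring (pi P) f.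
Proof.
move=> [c h]; have [//|/dm_reg h'] := pl_valuation_ring L (pi P) f.
have [->|f0] := eqVneq f 0; first exact: local_ring0.
have := value_atM h h'; rewrite mulr0 fmorphV divff ?fmorph_eq0 //.
by move/(value_at_uniq (value_at1 P))/eqP; rewrite oner_eq0.
Qed.

Lemma value_descend P f c : value_at P (j f) c -> value_at (pi P) f c.
Proof.
move=> h; have [|c' h'] := @local_ring_descend P f; first by exists c.
by rewrite (value_at_uniq h (dm_reg h')).
Qed.

(* A function vanishing at P', regular at sigma P' and nonzero on the orbit of P
   would have a norm with two values at pi P. *)
Lemma fibre_orbit P P' : pi P' = pi P -> P' = P \/ P' = sigma P.
Proof.
move=> e; have [->|ne] := eqVneq P' P; first by left.
right; apply/eqP; apply: contraT => ne'.
have [|z [z0 zL zM]] := @separating_function k X P' [:: P; sigma P] [:: sigma P'].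
  by rewrite !inE negb_or ne.
have [a a0 za] := zL P (mem_head _ _).
have [|b b0 zb] := zL (sigma P); first by rewrite !inE eqxx orbT.
have [|c zc] := zM (sigma P'); first exact: mem_head.
have [f ef] := norm_pull z.
have h1 : value_at P (j f) (a * b) by rewrite ef; apply: value_atM => //; exact: dm_reg.
have h2 : value_at P' (j f) (0 * c) by rewrite ef; apply: value_atM => //; exact: dm_reg.
have := value_at_uniq (value_descend h1) _; rewrite -e => /(_ _ (value_descend h2))/eqP.
by rewrite mul0r mulf_eq0 (negPf a0) (negPf b0).
Qed.

(** With trace [f] and norm [h] one has [j h = (j f - z) * z], so [z] has no zero where the trace
    and the inverse norm are regular. *)
Lemma finite_zeros z : z != 0 ->
  exists S : seq (point Y), forall P, pi P \notin S -> ~ value_at P z 0.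
Proof.
move=> z0; have [f ef] := trace_pull z; have [h eh] := norm_pull z.
have h0 : h != 0.
  by rewrite -(fmorph_eq0 j) eh mulf_neq0 // fmorph_eq0.
have [S1 hS1] := pl_finite_poles L f; have [S2 hS2] := pl_finite_poles L h^-1.
exists (S1 ++ S2) => P; rewrite mem_cat negb_or => /andP[/hS1 p1 /hS2 p2] zP.
have {}p1 := local_ring_pull p1; have {}p2 := local_ring_pull p2.
have : value_at P 1 0.
  rewrite (_ : 1 = j h^-1 * (j f - z) * z); last first.
    rewrite fmorphV -mulrA (_ : (j f - z) * z = j h) ?mulVf ?fmorph_eq0 //.
    rewrite ef eh; ring.
  apply: value_atM0 => //; apply: local_ringM => //; apply: local_ringB => //.
  by exists 0.
by move=> /(value_at_uniq (value_at1 P))/eqP; rewrite oner_eq0.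
Qed.

(** At points whose [i]-th entry is 1 the form [G] is tested through the function [G / 'X_i ^+ d],
    whose zeros lie over finitely many points; only finitely many [i] occur. *)
Lemma cofinite_open (U : set (point X)) P0 : zariski_open U -> U P0 ->
  exists S : seq (point Y), forall P, pi P \notin S -> U P.
Proof.
move=> [B [hB ->]] /= [G BG G0]; have [d hG] := hB G BG.
have Gn0 := pv_eval_neq0 hG G0.
suff [S hS] : exists S : seq (point Y), forall (i : 'I_(pv_n X).+1) P, pi P \notin S ->
    val P 0 i = 1 -> pt_eval P G != 0.
  exists S => P PS; exists G => //.
  by have [i Pi _] := normalizedP P; exact: hS PS Pi.
have hi (i : 'I_(pv_n X).+1) : exists S : seq (point Y), forall P, pi P \notin S ->
    val P 0 i = 1 -> pt_eval P G != 0.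
  pose M : {mpoly k[(pv_n X).+1]} := 'X_i ^+ d.
  have hM : M \is d.-homog by rewrite -[d]mul1n; exact/dhomogMn/dhomogXi.
  have [M0|M0] := eqVneq (pv_eval M) 0.
    exists [::] => P _ Pi; have : pt_eval P M != 0.
      by rewrite /pt_eval rmorphXn /= mevalXU Pi expr1n oner_neq0.
    by move/(pv_eval_neq0 hM); rewrite M0 eqxx.
  have [|S hS] := @finite_zeros (pv_eval G / pv_eval M).
    by rewrite mulf_neq0 ?invr_eq0.
  exists S => P /hS nz Pi; apply/eqP => PG; apply: nz.
  exists d, G, M; rewrite PG mul0r; split=> //.
  by rewrite /pt_eval rmorphXn /= mevalXU Pi expr1n oner_neq0.
have [S hS] := choice hi.
exists (flatten [seq S i | i <- enum 'I_(pv_n X).+1]) => i P PS.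
apply: hS; apply: contra PS => PS; apply/flattenP; exists (S i) => //.
by rewrite map_f // mem_enum.
Qed.

Lemma partition_function P P' : P != P' -> exists e, value_at P e 1 /\ value_at P' e 0.
Proof.
move=> ne; have [|z [z0 zL _]] := @separating_function k X P' [:: P] [::].
  by rewrite inE eq_sym.
have [c c0 zc] := zL P (mem_head _ _); exists (pv_const X c^-1 * z); split.
  by rewrite -(mulVf c0); apply: value_atM => //; exact: value_atC.
by rewrite -(mulr0 c^-1); apply: value_atM => //; exact: value_atC.
Qed.

(** [y] is the mean of [z] and [z'] with weights [e ^+ m] and [(1 - e) ^+ m]. At [P] the difference
    [y - z] carries a high power of [1 - e], which absorbs the pole of [z' - z]; at [P'] the powers
    of [e] do the same. *)
Lemma approximation2 P P' (z z' : K) : P != P' ->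
  exists y, local_ring P (y - z) /\ local_ring P' (y - z').
Proof.
move=> ne; have [e [e1 e0]] := partition_function ne.
have f0 : value_at P (1 - e) 0 by rewrite -(subrr 1); apply: value_atB => //; exact: value_at1.
have f1 : value_at P' (1 - e) 1.
  by rewrite -[X in value_at _ _ X]subr0; apply: value_atB => //; exact: value_at1.
have [m0 h0] := local_ring_archimedean hX (z' - z) f0.
have [m1 h1] := local_ring_archimedean hX (z' - z) e0.
(* A positive exponent makes the [m]-th power of the value 0 vanish, so the sum [D] of the weights
   has value 1 at both points. *)
pose m := (m0 + m1).+1; pose D := e ^+ m + (1 - e) ^+ m.
have D1 : value_at P D 1.
  rewrite -[X in value_at _ _ X]addr0; apply: value_atD.
    by rewrite -[X in value_at _ _ X](expr1n _ m); exact: value_atX.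
  by rewrite -[X in value_at _ _ X](expr0n _ m); exact: value_atX.
have D1' : value_at P' D 1.
  rewrite -[X in value_at _ _ X]add0r; apply: value_atD; last first.
    by rewrite -[X in value_at _ _ X](expr1n _ m); exact: value_atX.
  by rewrite -[X in value_at _ _ X](expr0n _ m); exact: value_atX.
have D0 := value_at_neq0 (oner_neq0 _) D1.
have DV : local_ring P D^-1 by exists 1^-1; apply: value_atV => //; exact: oner_neq0.
have DV' : local_ring P' D^-1 by exists 1^-1; apply: value_atV => //; exact: oner_neq0.
have em : (1 - e) ^+ m = D - e ^+ m by rewrite /D addrAC subrr add0r.
exists ((e ^+ m * z + (1 - e) ^+ m * z') / D); split.
  rewrite (_ : _ - z = (1 - e) ^+ (m1.+1) * ((1 - e) ^+ m0 * (z' - z)) / D).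
    by do 2![apply: local_ringM => //]; apply: local_ringX; exists 0.
  rewrite mulrA -exprD addSn [(m1 + m0)%N]addnC -/m em; field.
  by [].
rewrite (_ : _ - z' = - (e ^+ m0.+1 * (e ^+ m1 * (z' - z)) / D)).
  by apply: local_ringN; do 2![apply: local_ringM => //]; apply: local_ringX; exists 0.
rewrite mulrA -exprD addSn -/m em; field.
by [].
Qed.

Lemma fibre_approximation (c : point X -> K) (Q : point Y) :
  exists y, forall P, pi P = Q -> local_ring P (y - c P).
Proof.
have [[P eP]|none] := pselect (exists P, pi P = Q); last first.
  by exists 0 => P eP; case: none; exists P.
have hfib P' : pi P' = Q -> P' = P \/ P' = sigma P by rewrite -eP; exact: fibre_orbit.
have [e|ne] := eqVneq P (sigma P).
  exists (c P) => P' /hfib h; have -> : P' = P by case: h => // ->.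
  by rewrite subrr; exact: local_ring0.
have [y [h h']] := approximation2 (c P) (c (sigma P)) ne.
by exists y => P' /hfib[] ->.
Qed.

(** * Differentials on the cover and their traces *)

Section Differentials.
Variables (g : nat).
Hypotheses (hg : has_genus X g) (g_gt0 : (0 < g)%N).
Local Notation iota := (pv_const X).
Local Notation T := (pl_T L).
Local Notation t := (j (pl_T L)).

Lemma cover_surjective Q : exists P, pi P = Q.
Proof.
apply: contrapT => /forallNP none; have [w w0 hw] := genus_form_neq0 hg g_gt0.
(* The inverse parameter has its only pole at the missed point [Q], so its pull-back is regular on
   all of [X]. *)
have [|c ec] := @genus_regular_const _ _ _ (j (pl_param L Q)^-1) w hg _ hw w0.
  by move=> P; apply: local_ring_pull; apply: pl_param_inv; apply/eqP; exact: none.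
have := pl_param_nonconst L Q c^-1; apply/negP; rewrite negbK -(inj_eq (fmorph_inj j)).
by rewrite dm_const [iota _]fmorphV -ec fmorphV invrK.
Qed.

Lemma pull_poly_at u p : j (poly_at (pv_const Y) u p) = poly_at iota (j u) p.
Proof.
elim/poly_ind: p => [|p c IH]; first by rewrite !rmorph0.
by rewrite !(rmorphD, rmorphM) /= !poly_atC !poly_atX dm_const IH.
Qed.

Lemma kd_pull f : exists a, kd iota (j f) = a *: kd iota t.
Proof.
have [p [q [q0 ->]]] := pl_frac L f.
have q0' : poly_at iota t q != 0.
  rewrite -pull_poly_at fmorph_eq0; apply: contraNneq q0 => /poly_at_eq0 -> // r.
  exact: pl_T_nonconst.
rewrite rmorphM fmorphV !pull_poly_at kdM kdV // !kd_poly !scalerA -scalerDl.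
by eexists.
Qed.

(** Differentiating y^2 = f y - h gives (2y - f) dy = y df - dh, and 2y - f = y - s y is nonzero in
    every characteristic. *)
Lemma kd_span z : exists a, kd iota z = a *: kd iota t.
Proof.
have [y [f [sy ef hy]]] := inv_basis; have [h eh] := norm_pull y.
have [f0 [f1 ->]] := hy z.
suff [a ea] : exists a, kd iota y = a *: kd iota t.
  have [b0 e0] := kd_pull f0; have [b1 e1] := kd_pull f1.
  by rewrite kdD kdM e0 e1 ea !scalerA -!scalerDl; eexists.
have [b eb] := kd_pull f; have [c ec] := kd_pull h.
have d0 : y - s y != 0 by rewrite subr_eq0 eq_sym.
have e1 : y * y = y * j f - j h by rewrite ef eh; ring.
have := congr1 (kd iota) e1; rewrite kdB !kdM eb ec => e2.
exists ((y - s y)^-1 * (y * b - c)); apply: (scalerI d0).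
rewrite !scalerA mulrA divff // mul1r.
have -> : y - s y = y + y - j f by rewrite ef; ring.
by rewrite !scalerBl scalerDl e2 scalerA addrAC addrK.
Qed.

Lemma kd_param_neq0 : kd iota t != 0.
Proof.
have [w w0 _] := genus_form_neq0 hg g_gt0; have [a ea] := kaehler_span kd_span w.
by apply: contraNneq w0 => e; rewrite ea e scaler0.
Qed.

Lemma kd_coordinate : exists lam : kaehler iota -> K, forall w, w = lam w *: kd iota t.
Proof. by have [l hl] := choice (kaehler_span kd_span); exists l. Qed.

(** * Coefficients of forms with respect to dt; [lam w] is w/dt *)

Section Coordinate.
Variables (lam : kaehler iota -> K).
Hypothesis lamE : forall w, w = lam w *: kd iota t.
Local Notation D z := (lam (kd iota z)).

Lemma lamP w a : w = a *: kd iota t -> lam w = a.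
Proof.
move=> e; have /eqP := lamE w; rewrite {1}e -subr_eq0 -scalerBl scaler_eq0.
by rewrite (negPf kd_param_neq0) orbF subr_eq0 => /eqP.
Qed.

Lemma lamD v w : lam (v + w) = lam v + lam w.
Proof. by apply: lamP; rewrite scalerDl -!lamE. Qed.

Lemma lamZ a w : lam (a *: w) = a * lam w.
Proof. by apply: lamP; rewrite -scalerA -lamE. Qed.

Lemma lam_sum m (v : 'I_m -> kaehler iota) : lam (\sum_i v i) = \sum_i lam (v i).
Proof.
elim/big_rec2: _ => [|i x y _ e]; first by apply: lamP; rewrite scale0r.
by rewrite lamD e.
Qed.

Lemma lam_inv w : lam (kaehler_map iota s w) = s (lam w).
Proof.
apply: lamP; rewrite {1}[w]lamE kaehler_mapZ ?kaehler_map_d ?inv_pull //; exact: dm_const.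
Qed.

Lemma dvD x y : D (x + y) = D x + D y. Proof. by rewrite kdD lamD. Qed.
Lemma dvM x y : D (x * y) = x * D y + y * D x. Proof. by rewrite kdM lamD !lamZ. Qed.
Lemma dv_inv z : D (s z) = s (D z).
Proof. by rewrite -lam_inv kaehler_map_d //; exact: dm_const. Qed.

Lemma dv_pt a : D (j (pl_param L (pl_pt L a))) = 1.
Proof.
by rewrite pl_param_pt rmorphB dm_const kdB kdC subr0; apply: lamP; rewrite scale1r.
Qed.

Lemma dv_inf : D (j (pl_param L (pl_inf L))) = - (t^-1 ^+ 2).
Proof. by apply: lamP; rewrite pl_param_inf fmorphV kdV ?fmorph_eq0 ?pl_T_neq0. Qed.

Lemma dv_param Q : D (j (pl_param L Q)) != 0.
Proof.
have [->|[a ->]] := pl_pointP L Q; last by rewrite dv_pt oner_neq0.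
by rewrite dv_inf oppr_eq0 expf_eq0 invr_eq0 fmorph_eq0 (negPf (pl_T_neq0 L)) andbF.
Qed.

Section Fibre.
Variable Q : point Y.
Local Notation U := (D (j (pl_param L Q))).
Local Notation DQ z := (D z / D (j (pl_param L Q))).

(** [DQ] is differentiation with respect to the parameter at [Q]; the quotient rule applies to a
    quotient of polynomials in it. *)
Lemma dv_regular f : local_ring Q f -> exists2 f', local_ring Q f' & DQ (j f) = j f'.
Proof.
move=> [c /(pl_valueP L)[p [q [q0 -> _]]]]; set u := pl_param L Q.
have u0 : value_at Q u 0 by exact: pl_param_value.
have hq : value_at Q (poly_at (pv_const Y) u q) q.[0] by exact: value_at_poly.
have qn0 := value_at_neq0 q0 hq.
have hp r : local_ring Q (poly_at (pv_const Y) u r) by apply: local_ring_poly; exists 0.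
exists ((poly_at (pv_const Y) u (p^`() * q - p * q^`())) / poly_at (pv_const Y) u q ^+ 2).
  apply: local_ringM => //; exists (q.[0] ^+ 2)^-1.
  by apply: value_atV; rewrite ?expf_neq0 //; exact: value_atX.
have un0 := dv_param Q; rewrite -/u in un0 *.
have qn0' : poly_at iota (j u) q != 0 by rewrite -pull_poly_at fmorph_eq0.
rewrite !(rmorphM, fmorphV, rmorphXn, rmorphB) /= !pull_poly_at.
rewrite kdM kdV // !kd_poly lamD !lamZ; field.
by rewrite qn0' un0.
Qed.

(** Applying [s] forces [j f1] to be the given quotient, and regularity at [P] descends to [Q]. *)
Lemma fibre_basis P z b : pi P = Q -> z - s z != 0 ->
  local_ring P z -> local_ring P b -> local_ring P ((b - s b) / (z - s z)) ->
  exists f0 f1, [/\ local_ring Q f0, local_ring Q f1 & b = j f0 + j f1 * z].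
Proof.
move=> eP z0 hz hb hr; have sz : s z != z by rewrite eq_sym -subr_eq0.
have [f0 [f1 eb]] := quadratic_basis b sz; exists f0, f1.
have ef1 : j f1 = (b - s b) / (z - s z).
  by rewrite eb rmorphD rmorphM !inv_pull; apply: (canRL (mulfK z0)); ring.
have h1 : local_ring P (j f1) by rewrite ef1.
have ef0 : j f0 = b - j f1 * z by rewrite eb addrK.
have h0 : local_ring P (j f0) by rewrite ef0; apply: local_ringB => //; exact: local_ringM.
by split=> //; rewrite -eP; exact: local_ring_descend.
Qed.

Lemma local_ring_trace P z f : pi P = Q -> local_ring P z -> local_ring (sigma P) z ->
  j f = z + s z -> local_ring Q f.
Proof.
move=> eP hz hz' ef; rewrite -eP; apply: local_ring_descend; rewrite ef.
by apply: local_ringD => //; exact: local_ring_pull.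
Qed.

Lemma local_ring_norm P z f : pi P = Q -> local_ring P z -> local_ring (sigma P) z ->
  j f = z * s z -> local_ring Q f.
Proof.
move=> eP hz hz' ef; rewrite -eP; apply: local_ring_descend; rewrite ef.
by apply: local_ringM => //; exact: local_ring_pull.
Qed.

Lemma pull_regular P f : pi P = Q -> local_ring Q f -> local_ring P (j f).
Proof. by move=> <-; exact: local_ring_pull. Qed.

(** [e] is 1 at [P] and 0 at [sigma P], so [e - s e] is a unit at [P] and functions regular at both
    points are combinations of 1 and [e]. The derivative of [e] comes from its quadratic
    equation. *)
Lemma dv_regular_split P z : pi P = Q -> P != sigma P ->
  local_ring P z -> local_ring P (DQ z).
Proof.
move=> eP ne hz; have [e [e1 e0]] := partition_function ne.
have he : local_ring P e by exists 1.
have he' : local_ring (sigma P) e by exists 0.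
have se0 : value_at P (s e) 0 by exact: dm_reg.
have d1 : value_at P (e - s e) 1.
  by rewrite -[X in value_at _ _ X]subr0; exact: value_atB.
have d0 : e - s e != 0 := value_at_neq0 (oner_neq0 _) d1.
have dV : local_ring P (e - s e)^-1 by exists 1^-1; apply: value_atV => //; exact: oner_neq0.
have un0 := dv_param Q.
have De : local_ring P (DQ e).
  have [f ef] := trace_pull e; have [h eh] := norm_pull e.
  have [f' hf' ef'] := dv_regular (local_ring_trace eP he he' ef).
  have [h' hh' eh'] := dv_regular (local_ring_norm eP he he' eh).
  rewrite (_ : DQ e = (e * j f' - j h') / (e - s e)).
    apply: local_ringM => //; apply: local_ringB; last exact: pull_regular.
    by apply: local_ringM => //; exact: pull_regular.
  rewrite -ef' -eh' ef eh dvD dvM; field; by rewrite d0 un0.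
have DA b : local_ring P b -> local_ring (sigma P) b -> local_ring P (DQ b).
  move=> hb hb'; have [|f0 [f1 [h0 h1 ->]]] := fibre_basis eP d0 he hb.
    by apply: local_ringM => //; apply: local_ringB => //; exact: local_ring_pull.
  have [f0' hf0' ef0'] := dv_regular h0; have [f1' hf1' ef1'] := dv_regular h1.
  rewrite (_ : DQ _ = j f0' + (j f1 * DQ e + e * j f1')).
    apply: local_ringD; first exact: pull_regular.
    by apply: local_ringD; apply: local_ringM => //; exact: pull_regular.
  rewrite -ef0' -ef1' dvD dvM; field; exact: un0.
(* [z] may have a pole at [sigma P]; a power of [e] removes it, and the product rule recovers the
   derivative of [z]. *)
have [m hm] := local_ring_archimedean hX z e0.
have em1 : value_at P (e ^+ m) 1.
  by rewrite -[X in value_at _ _ X](expr1n _ m); exact: value_atX.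
have em0 := value_at_neq0 (oner_neq0 _) em1.
rewrite (_ : DQ z = (DQ (e ^+ m * z) - z * DQ (e ^+ m)) / e ^+ m); last first.
  by rewrite dvM; field; rewrite em0 un0.
apply: local_ringM; last by exists 1^-1; apply: value_atV => //; exact: oner_neq0.
apply: local_ringB.
  by apply: DA => //; apply: local_ringM => //; exact: local_ringX.
by apply: local_ringM => //; apply: DA; exact: local_ringX.
Qed.

Lemma inv_dv_param : s U = U.
Proof. by rewrite -dv_inv inv_pull. Qed.

(* At a fixed point the local ring is free over that of the line, with basis 1
   and an element z minimizing the valuation of z - s z. *)
Lemma dv_trace_ramified P a b : pi P = Q -> P = sigma P ->
  local_ring P a -> local_ring P b -> local_ring P (a * DQ b + s (a * DQ b)).
Proof.
move=> eP fixP ha hb; have un0 := dv_param Q.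
have hs z : local_ring P z -> local_ring P (s z).
  by move=> /local_ring_inv; rewrite -fixP.
have [||_ [[z hz <-] z0 zmin]] := @minimal_valuation k X hX P
    [set b' | exists2 z, local_ring P z & z - s z = b'].
- by move=> _ [z hz <-]; apply: local_ringB => //; exact: hs.
(* Either [y] or its inverse is regular at [P], and [s] moves both. *)
- have [y sy] := inv_nontrivial.
  have [hy|hy] := valuation_ring hX P y.
    by exists (y - s y); [exists y|rewrite subr_eq0 eq_sym].
  exists (y^-1 - s y^-1); first by exists y^-1 => //; exists 0.
  by rewrite subr_eq0 fmorphV eq_sym (inj_eq invr_inj).
have hz' : local_ring (sigma P) z by rewrite -fixP.
have basis c : local_ring P c ->
    exists f0 f1, [/\ local_ring Q f0, local_ring Q f1 & c = j f0 + j f1 * z].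
  by move=> hc; apply: (fibre_basis eP z0 hz hc); apply: zmin; exists c.
have [p [q [hp hq ->]]] := basis a ha; have [r [m [hr hm ->]]] := basis b hb.
have [r' hr' er] := dv_regular hr; have [m' hm' em] := dv_regular hm.
have [f ef] := trace_pull z; have [h eh] := norm_pull z.
have hf := local_ring_trace eP hz hz' ef; have hh := local_ring_norm eP hz hz' eh.
have [f' hf' ef'] := dv_regular hf; have [h' hh' eh'] := dv_regular hh.
pose c := (j p + j q * z) * (j r' + j m' * z).
have hc : local_ring P c.
  apply: local_ringM; apply: local_ringD; try apply: local_ringM => //;
    exact: pull_regular.
(* The derivative of [z] may have a pole, but its trace is [f'], and the trace of its product with
   [z] is [f f' - h']. The terms without it make up the regular function [c]. *)
rewrite (_ : _ + _ = c + s c + (j p * j m * j f' + j q * j m * (j f * j f' - j h'))).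
  apply: local_ringD; first by apply: local_ringD => //; exact: hs.
  apply: local_ringD; first by apply: local_ringM; [apply: local_ringM|]; exact: pull_regular.
  apply: local_ringM; first by apply: local_ringM; exact: pull_regular.
  by apply: local_ringB; [apply: local_ringM|]; exact: pull_regular.
rewrite /c -er -em -ef' -eh' ef eh !(rmorphD, rmorphM, fmorphV) /= -!dv_inv.
rewrite !dvD !dvM !(rmorphD, rmorphM) /= !inv_pull !dvD !dvM; field.
exact: un0.
Qed.

(** Off the fixed points each summand is regular on its own; at a fixed point only the sum is
    controlled. *)
Lemma dv_trace P w : pi P = Q -> dregular P w -> dregular (sigma P) w ->
  local_ring P (lam w / U + s (lam w / U)).
Proof.
move=> eP hw hw'; have [e|ne] := eqVneq P (sigma P).
  have [m [a [b [hab ->]]]] := hw.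
  rewrite lam_sum mulr_suml rmorph_sum -big_split /=.
  apply: local_ring_sum => i _; rewrite lamZ -mulrA; have [? ?] := hab i.
  exact: dv_trace_ramified.
have hsplit P' : pi P' = Q -> P' != sigma P' -> dregular P' w -> local_ring P' (lam w / U).
  move=> eP' ne' [m [a [b [hab ->]]]].
  rewrite lam_sum mulr_suml; apply: local_ring_sum => i _; rewrite lamZ -mulrA.
  by have [? ?] := hab i; apply: local_ringM => //; exact: dv_regular_split.
apply: local_ringD; first exact: hsplit.
apply: local_ring_pull; apply: hsplit; rewrite ?cover_inv ?inv_pt_invol //.
by rewrite eq_sym.
Qed.

End Fibre.

(** The quotient is the coefficient of psi dt with respect to the parameter at [Q], so psi dt comes
    from a regular form on the line. *)
Lemma trace_form_eq0 psi :
  (forall Q, exists2 f, local_ring Q f & psi / D (j (pl_param L Q)) = j f) -> psi = 0.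
Proof.
move=> h; have hpt a : exists2 f, local_ring (pl_pt L a) f & psi = j f.
  by have [f hf] := h (pl_pt L a); rewrite dv_pt divr1; exists f.
have [f _ ef] := hpt 0; have [f' hf'] := h (pl_inf L).
rewrite dv_inf ef invrN exprVn invrK => ef'; rewrite (_ : f = 0) ?rmorph0 //.
apply: (@pl_no_differential _ _ L) => [a|].
  by have [f0 h0] := hpt a; rewrite ef => /fmorph_inj ->.
rewrite (_ : _ * _ = - f'); first exact: local_ringN.
by apply: (fmorph_inj j); rewrite rmorphN -ef' !(rmorphM, rmorphXn); ring.
Qed.

End Coordinate.

(** * Triviality of the trace of a hypercocycle *)

Lemma trace_coboundary (c : hypercochain X) :
  is_hypercocycle c -> is_hypercoboundary (hpull sigma c + c).
Proof.
move=> [V [cov hO hW hadd hd]]; have [lam lamE] := kd_coordinate.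
have [P0 _] := cover_surjective (pl_inf L).
(* Additivity makes [c.1] the coboundary of [cc], which leaves the functions [cc P] and one form
   [eta0] such that eta0 + d(cc P) is regular at [P]. *)
pose cc P := c.1 P0 P; pose eta0 := c.2 P0.
have ec1 (x y : point X) : c.1 x y = cc y - cc x by rewrite /cc (hadd P0 x y) addrC addKr.
have ec2 x : c.2 x = eta0 + kd iota (cc x) by rewrite /cc hd /eta0 addrC subrK.
(* Outside the fibres over [S] a point [P] lies in the open set of [P0], so [cc P] is regular at [P]
   there. *)
have [S hS] := cofinite_open (cov P0).1 (cov P0).2.
have [cQ hcQ] := choice (fibre_approximation cc).
have [tQ htQ] := choice (fun Q => trace_pull (cQ Q)).
have hcQ' P : local_ring P (cQ (pi P) - cc P) by exact: hcQ.
have [Q QS|h hh] := @pl_cousin _ _ L tQ S.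
  have [P eP] := cover_surjective Q.
  have reg P' : pi P' = Q -> local_ring P' (cQ Q).
    move=> eP'; rewrite -[cQ Q](subrK (cc P')); apply: local_ringD; first exact: hcQ.
    by apply: hO; [apply: hS; rewrite eP'|have [] := cov P'].
  by apply: (local_ring_trace eP _ _ (htQ Q)); apply: reg; rewrite ?cover_inv.
pose H P := cc P + s (cc (sigma P)) - j h.
have hH P : local_ring P (H P).
  have -> : H P = - (cQ (pi P) - cc P) - s (cQ (pi P) - cc (sigma P)) + j (tQ (pi P) - h).
    by rewrite /H rmorphB [j (_ - _)]rmorphB htQ; ring.
  apply: local_ringD; last by apply: local_ring_pull; exact: hh.
  apply: local_ringB; first exact: local_ringN.
  by apply: local_ring_pull; apply: hcQ; exact: cover_inv.
pose eta := eta0 + kaehler_map iota s eta0.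
have eta_h : eta + kd iota (j h) = 0.
  rewrite [LHS]lamE (_ : lam _ = 0) ?scale0r //; apply: (trace_form_eq0 lamE) => Q.
  (* At each [P'] over [Q] the form [w] differs from [c.2 P'] by the differential of a regular
     function. Its trace is therefore regular at [Q], and it exceeds eta + dh by d(tQ - h), which is
     regular too. *)
  have [P eP] := cover_surjective Q; pose w := eta0 + kd iota (cQ Q).
  have hw P' : pi P' = Q -> dregular P' w.
    move=> eP'; rewrite (_ : w = c.2 P' + kd iota (cQ Q - cc P')); last first.
      by rewrite ec2 kdB -addrA [X in _ = _ + X]addrC subrK.
    apply: dregularD; first by apply: hW; have [] := cov P'.
    by apply: dregular_kd; exact: hcQ.
  have [f ef] := trace_pull (lam w / lam (kd iota (j (pl_param L Q)))).
  have hf : local_ring Q f.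
    rewrite -eP; apply: local_ring_descend; rewrite ef.
    by apply: dv_trace => //; apply: hw; rewrite ?cover_inv.
  have [|f' hf' ef'] := @dv_regular _ lamE Q (h - tQ Q).
    by rewrite -opprB; apply: local_ringN; exact: hh.
  exists (f + f'); first exact: local_ringD.
  rewrite rmorphD ef -ef' rmorphM fmorphV inv_dv_param // -!mulrDl; congr (_ / _).
  rewrite /w /eta !lamD // rmorphD lam_inv // rmorphB kdB htQ kdD.
  rewrite -[X in _ = _ + X]/(lam (_ - _)) -scaleN1r lamD // lamZ // lamD // -dv_inv //.
  ring.
exists (fun x => [set P | local_ring P (H x)]), H; split => //=.
- by move=> x; split; [exact: local_ring_zariski_open|exact: hH].
- move=> x y; change (s (c.1 (sigma x) (sigma y)) + c.1 x y = H y - H x).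
  by rewrite !ec1 /H rmorphB; ring.
- move=> x; change (kaehler_map iota s (c.2 (sigma x)) + c.2 x = kd iota (H x)).
  rewrite !ec2 kaehler_mapD ?kaehler_map_d ?kdB ?kdD; try exact: dm_const.
  (* The vanishing just shown replaces -dh by [eta]. *)
  rewrite -[X in _ = _ - X](addKr eta) eta_h addr0 opprK /eta.
  by rewrite addrACA addrC [X in _ + X = _]addrC [kd _ _ + _]addrC.
Qed.

End Differentials.
End DoubleCover.

Theorem theorem3p1 (k : closedFieldType) (X : proj_variety k) (g : nat)
    (pi : dominant_morphism X (P1 k)) (sigma : dominant_morphism X X) :
  smooth_curve X ->
  has_genus X g -> (2 <= g)%N ->
  separable_morphism pi -> has_degree pi 2 ->
  is_automorphism sigma -> ~ dm_eq sigma (dm_id X) ->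
  dm_eq (dm_comp pi sigma) pi ->
  forall c : H1dR X, H1dR_pull sigma c = (-1) *: c.
Proof.
move=> hX hg g2 _ hdeg _ hsig hpis c.
rewrite -[c]lquot_piK H1dR_pullE -linearZ; set r := repr c.
apply/lquot_piP/asboolP.
have -> : val (cocycle_pull sigma r - (-1) *: r) = hpull sigma (val r) + val r.
  by rewrite scaleN1r opprK.
have /asboolP := valP r.
exact: (trace_coboundary (P1_line k) hX hdeg hsig hpis hg (ltnW g2)).
Qed.
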